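(* Let $\Pi=\{\mathcal H,\Gamma_0,\Gamma_1\}$ be a unitary boundary triple for $A^*$ with Weyl function $M(\cdot)$ and $\gamma$-field $\gamma(\cdot)$. Then the following statements are equivalent: (i) $\Pi$ is an ES-generalized boundary triple for $A^*$, i.e. $A_0=\ker\Gamma_0$ is essentially selfadjoint; (ii) $\gamma(i)$ and $\gamma(-i)$ are closable; (iii) $\gamma(\lambda)$ is closable for every $\lambda\in\mathbb C_+\cup\mathbb C_-$, and $\operatorname{dom}\overline{\gamma(\lambda)}=\operatorname{dom}\overline{\gamma(\pm i)}$ for all $\lambda\in\mathbb C_\pm$; (iv) the forms $\mathfrak t_{M(i)}$ and $\mathfrak t_{M(-i)}$ are closable; (v) the form $\mathfrak t_{M(\lambda)}$ is closable for every $\lambda\in\mathbb C_\pm$ and $\operatorname{dom}\overline{\mathfrak t_{M(\lambda)}}=\operatorname{dom}\overline{\mathfrak t_{M(\pm i)}}$ for $\lambda\in\mathbb C_\pm$; (vi) $M(\cdot)\in\mathcal R^s(\mathcal H)$ and $M$ is form domain invariant in $\mathbb C_+$ and in $\mathbb C_-$. Moreover, if these conditions hold, then $\operatorname{dom}\overline{\mathfrak t_{M(\lambda)}}=\operatorname{dom}\overline{\gamma(\lambda)}=\operatorname{ran}\overline{\Gamma_0}$ for all $\lambda\in\mathbb C\setminus\mathbb R$, where $\overline{\Gamma_0}$ is the closure of $\Gamma_0$ as a linear relation from $\mathfrak H^2$ to $\mathcal H$.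
   Context: All Hilbert spaces are separable. A linear relation from $\mathfrak X$ to $\mathfrak Y$ is a linear subspace of $\mathfrak X\times\mathfrak Y$; operators are identified with their graphs; $\operatorname{dom},\operatorname{ran},\ker$, $\operatorname{mul}T=\{g:\{0,g\}\in T\}$, closure, inverse and adjoint are defined as usual for relations. A relation $T$ in $\mathfrak H$ is symmetric if $T\subset T^*$, selfadjoint if $T=T^*$, essentially selfadjoint if $\overline T=T^*$. $A$ is a closed symmetric linear relation in a Hilbert space $\mathfrak H$; $\mathcal H$ is another Hilbert space. Elements of $\mathfrak H^2$ are written $\hat f=\{f,f'\}$. A linear operator $\Gamma=\{\Gamma_0,\Gamma_1\}$ from $\mathfrak H^2$ to $\mathcal H^2$ is isometric if the Green identity $(f',g)_{\mathfrak H}-(f,g')_{\mathfrak H}=(\Gamma_1\hat f,\Gamma_0\hat g)_{\mathcal H}-(\Gamma_0\hat f,\Gamma_1\hat g)_{\mathcal H}$ holds for all $\hat f,\hat g\in\operatorname{dom}\Gamma$, and unitary if moreover $\Gamma^{-1}=\Gamma^{[*]}$, where $\Gamma^{[*]}=\{\{\hat k,\hat g\}\in\mathcal H^2\times\mathfrak H^2:\ (f',g)-(f,g')=(h',k)-(h,k')\text{ for all }\{\hat f,\{h,h'\}\}\in\Gamma\}$ with $\hat k=\{k,k'\}$ (i.e. $\Gamma$ is unitary between the Kreĭn spaces $(\mathfrak H^2,J_{\mathfrak H})$, $(\mathcal H^2,J_{\mathcal H})$, $J=\begin{pmatrix}0&-iI\\ iI&0\end{pmatrix}$). $\{\mathcal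 H,\Gamma_0,\Gamma_1\}$ is a unitary (isometric) boundary triple for $A^*$ if $\Gamma$ is unitary (isometric) and $A_*:=\operatorname{dom}\Gamma\subset A^*$ is dense in $A^*$. $A_0:=\ker\Gamma_0$. Weyl function and $\gamma$-field: for $\lambda\in\mathbb C\setminus\mathbb R$ and $\hat f_\lambda=\{f_\lambda,\lambda f_\lambda\}\in A_*$, $M(\lambda)\Gamma_0\hat f_\lambda=\Gamma_1\hat f_\lambda$ and $\gamma(\lambda)\Gamma_0\hat f_\lambda=f_\lambda$ (so $\operatorname{dom}M(\lambda)=\operatorname{dom}\gamma(\lambda)=\Gamma_0(\{\{f,\lambda f\}\in A_*\})$). For an operator-valued $M$, $\mathfrak t_{M(\lambda)}[u,v]=\frac{1}{\lambda-\bar\lambda}[(M(\lambda)u,v)-(u,M(\lambda)v)]$, $u,v\in\operatorname{dom}M(\lambda)$. $M$ is form domain invariant in $\mathbb C_+$ ($\mathbb C_-$) if $\mathfrak t_{M(\lambda)}$ is closable for all $\lambda$ in that half-plane and the closures have a common domain. $\mathcal R(\mathcal H)$ is the class of functions on $\mathbb C\setminus\mathbb R$ whose values are closed operators in $\mathcal H$, maximal dissipative for $\lambda\in\mathbb C_+$, with $M(\lambda)^*=M(\bar\lambda)$ and $\lambda\mapsto(M(\lambda)+\mu)^{-1}$ holomorphic on $\mathbb C_+$ (some/all $\mu\in\mathbb C_+$); $\mathcal R^s(\mathcal H)$ consists of those $F\in\mathcal R(\mathcal H)$ with: $h\in\operatorname{dom}F(i)$, $\operatorname{Im}(F(i)h,h)=0\Rightarrow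 h=0$. *)

(* Defs.v *)
From Stdlib Require Import Reals.
From Coquelicot Require Import Coquelicot.
Set Implicit Arguments.
Open Scope R_scope.

Definition ipn {V : ModuleSpace C_Ring} (ip : V -> V -> C) (x : V) : R :=
  sqrt (Re (ip x x)).

Record hilbert := Hilbert {
  hcar :> ModuleSpace C_Ring;
  ip : hcar -> hcar -> C;
  ip_addl : forall x y z, ip (plus x y) z = Cplus (ip x z) (ip y z);
  ip_scall : forall (a : C) x y, ip (scal a x) y = Cmult a (ip x y);
  ip_sym : forall x y, ip y x = Cconj (ip x y);
  ip_pos : forall x, 0 <= Re (ip x x);
  ip_def : forall x, ip x x = RtoC 0 -> x = zero;
  h_complete : forall u : nat -> hcar,
    (forall eps, 0 < eps -> exists N, forall n m, (N <= n)%nat -> (N <= m)%nat ->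
        ipn ip (minus (u n) (u m)) < eps) ->
    exists l, forall eps, 0 < eps -> exists N, forall n, (N <= n)%nat ->
        ipn ip (minus (u n) l) < eps;
  h_separable : exists d : nat -> hcar,
    forall x eps, 0 < eps -> exists n, ipn ip (minus x (d n)) < eps
}.

Arguments ip {h}.

Section Hil.

Definition hnorm {H : hilbert} (x : H) : R := ipn (@ip H) x.

Definition conv {H : hilbert} (u : nat -> H) (l : H) : Prop :=
  forall eps, 0 < eps -> exists N, forall n, (N <= n)%nat -> hnorm (minus (u n) l) < eps.

Definition rel (X Y : Type) := X -> Y -> Prop.

Definition subspace {X Y : ModuleSpace C_Ring} (T : rel X Y) : Prop :=
  T zero zero /\
  (forall x y x' y', T x y -> T x' y' -> T (plus x x') (plus y y')) /\
  (forall (a : C) x y, T x y -> T (scal a x) (scal a y)).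

Definition rclosure {X Y : hilbert} (T : rel X Y) : rel X Y :=
  fun x y => exists (u : nat -> X) (v : nat -> Y),
    (forall n, T (u n) (v n)) /\ conv u x /\ conv v y.

Definition rclosed {X Y : hilbert} (T : rel X Y) : Prop :=
  forall x y, rclosure T x y -> T x y.

Definition is_operator {X Y : ModuleSpace C_Ring} (T : rel X Y) : Prop :=
  forall y, T zero y -> y = zero.

Definition closable {X Y : hilbert} (T : rel X Y) : Prop := is_operator (rclosure T).

Definition rdom {X Y : Type} (T : rel X Y) : X -> Prop := fun x => exists y, T x y.
Definition rran {X Y : Type} (T : rel X Y) : Y -> Prop := fun y => exists x, T x y.

Definition radjoint {H : hilbert} (T : rel H H) : rel H H :=
  fun g g' => forall f f', T f f' -> ip f' g = ip f g'.

Definition symmetric {H : hilbert} (T : rel H H) : Prop :=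
  forall f f', T f f' -> radjoint T f f'.

Definition ess_selfadjoint {H : hilbert} (T : rel H H) : Prop :=
  forall f f', rclosure T f f' <-> radjoint T f f'.

Definition dissipative {H : hilbert} (T : rel H H) : Prop :=
  forall u v, T u v -> 0 <= Im (ip v u).

Definition max_dissipative {H : hilbert} (T : rel H H) : Prop :=
  subspace T /\ dissipative T /\
  forall S : rel H H, subspace S -> dissipative S ->
    (forall u v, T u v -> S u v) -> forall u v, S u v -> T u v.

(** A : closed symmetric linear relation in H;
    Astar = A_* = dom Gamma (a set of pairs {f,f'}), G0, G1 = Gamma_0, Gamma_1 *)
Definition green {H K : hilbert} (Astar : rel H H) (G0 G1 : H -> H -> K) : Prop :=
  forall f f' g g', Astar f f' -> Astar g g' ->
    Cminus (ip f' g) (ip f g') = Cminus (ip (G1 f f') (G0 g g')) (ip (G0 f f') (G1 g g')).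

Definition gamma_linear {H K : hilbert} (Astar : rel H H) (G0 G1 : H -> H -> K) : Prop :=
  subspace Astar /\
  (forall f f' g g', Astar f f' -> Astar g g' ->
     G0 (plus f g) (plus f' g') = plus (G0 f f') (G0 g g') /\
     G1 (plus f g) (plus f' g') = plus (G1 f f') (G1 g g')) /\
  (forall (a : C) f f', Astar f f' ->
     G0 (scal a f) (scal a f') = scal a (G0 f f') /\
     G1 (scal a f) (scal a f') = scal a (G1 f f')).

(** Gamma^{-1} = Gamma^{[*]} *)
Definition gamma_unitary {H K : hilbert} (Astar : rel H H) (G0 G1 : H -> H -> K) : Prop :=
  gamma_linear Astar G0 G1 /\ green Astar G0 G1 /\
  forall (k k' : K) (g g' : H),
    (Astar g g' /\ G0 g g' = k /\ G1 g g' = k') <->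
    (forall f f', Astar f f' ->
       Cminus (ip f' g) (ip f g') = Cminus (ip (G1 f f') k) (ip (G0 f f') k')).

Definition unitary_boundary_triple {H K : hilbert} (A : rel H H)
    (Astar : rel H H) (G0 G1 : H -> H -> K) : Prop :=
  gamma_unitary Astar G0 G1 /\
  (forall f f', Astar f f' -> radjoint A f f') /\
  (forall g g', radjoint A g g' -> rclosure Astar g g').

Definition A0 {H K : hilbert} (Astar : rel H H) (G0 : H -> H -> K) : rel H H :=
  fun f f' => Astar f f' /\ G0 f f' = zero.

(** gamma-field and Weyl function (as relations; they are operators) *)
Definition gammaF {H K : hilbert} (Astar : rel H H) (G0 : H -> H -> K) (l : C) : rel K H :=
  fun h f => Astar f (scal l f) /\ G0 f (scal l f) = h.

Definition Weyl {H K : hilbert} (Astar : rel H H) (G0 G1 : H -> H -> K) (l : C) : rel K K :=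
  fun h k => exists f : H, Astar f (scal l f) /\ G0 f (scal l f) = h /\ G1 f (scal l f) = k.

Definition tform {K : hilbert} (M : rel K K) (l : C) (u v : K) (c : C) : Prop :=
  exists Mu Mv, M u Mu /\ M v Mv /\
    c = Cdiv (Cminus (ip Mu v) (ip u Mv)) (Cminus l (Cconj l)).

Definition closed_nonneg_form {K : hilbert} (D : K -> Prop) (s : K -> K -> C) : Prop :=
  D zero /\ (forall u v, D u -> D v -> D (plus u v)) /\ (forall (a : C) u, D u -> D (scal a u)) /\
  (forall u v w, D u -> D v -> D w -> s (plus u v) w = Cplus (s u w) (s v w)) /\
  (forall (a : C) u v, D u -> D v -> s (scal a u) v = Cmult a (s u v)) /\
  (forall u v, D u -> D v -> s v u = Cconj (s u v)) /\
  (forall u, D u -> 0 <= Re (s u u)) /\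
  (forall (un : nat -> K) (u : K), (forall n, D (un n)) -> conv un u ->
     (forall eps, 0 < eps -> exists N, forall n m, (N <= n)%nat -> (N <= m)%nat ->
        Re (s (minus (un n) (un m)) (minus (un n) (un m))) < eps) ->
     D u /\ forall eps, 0 < eps -> exists N, forall n, (N <= n)%nat ->
        Re (s (minus (un n) u) (minus (un n) u)) < eps).

Definition form_extends {K : hilbert} (M : rel K K) (l : C) (D : K -> Prop) (s : K -> K -> C) :=
  (forall u, rdom M u -> D u) /\ (forall u v c, tform M l u v c -> s u v = c).

Definition form_closable {K : hilbert} (M : rel K K) (l : C) : Prop :=
  exists D s, closed_nonneg_form D s /\ form_extends M l D s.

(** domain of the closure = domain of the smallest closed extension *)
Definition dom_form_closure {K : hilbert} (M : rel K K) (l : C) (u : K) : Prop :=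
  forall D s, closed_nonneg_form D s -> form_extends M l D s -> D u.

Definition nevanlinna_R {K : hilbert} (M : C -> rel K K) : Prop :=
  (forall l, Im l <> 0 -> subspace (M l) /\ rclosed (M l) /\ is_operator (M l)) /\
  (forall l, 0 < Im l -> max_dissipative (M l)) /\
  (forall l, Im l <> 0 -> forall u v, radjoint (M l) u v <-> M (Cconj l) u v) /\
  (exists mu, 0 < Im mu /\
     forall h k : K, exists phi : C -> C,
       forall z, 0 < Im z ->
         @ex_derive C_AbsRing C_NormedModule phi z /\
         (exists g, M z g (minus h (scal mu g))) /\
         (forall g, M z g (minus h (scal mu g)) -> phi z = ip g k)).

Definition nevanlinna_Rs {K : hilbert} (M : C -> rel K K) : Prop :=
  nevanlinna_R M /\
  forall h Mh, M Ci h Mh -> Im (ip Mh h) = 0 -> h = zero.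

Definition form_domain_invariant {K : hilbert} (M : C -> rel K K) (P : C -> Prop) : Prop :=
  (forall l, P l -> form_closable (M l) l) /\
  exists D : K -> Prop, forall l, P l -> forall u, dom_form_closure (M l) l u <-> D u.

Definition ran_closure_G0 {H K : hilbert} (Astar : rel H H) (G0 : H -> H -> K) (h : K) : Prop :=
  exists (fn fn' : nat -> H) (f f' : H),
    (forall n, Astar (fn n) (fn' n)) /\ conv fn f /\ conv fn' f' /\
    conv (fun n => G0 (fn n) (fn' n)) h.

End Hil.

Definition Cp (l : C) : Prop := 0 < Im l.
Definition Cm (l : C) : Prop := Im l < 0.
Definition mCi : C := Cconj Ci.

(* Main.v *)
(** Unitarity of Gamma makes the boundary problem f' - z f = r, G1 f + mu G0 f = s uniquely and
    boundedly solvable on A_* whenever Im z and Im mu have the same sign: Green's identity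
    gives the lower bound, unitarity gives closedness and the triviality of the orthogonal
    complement of the range.  Everything else is read off from this.

    Green's identity between A_0 and the defect spaces shows that gamma(l)^* has domain
    ran (A_0 - conj l), so gamma(l) is closable exactly when that range is dense, and the two
    ranges at i and -i decide essential selfadjointness.  Since t_{M(l)}[u, v] =
    (gamma(l) u, gamma(l) v), closability and domains of the forms are those of gamma(l).
    When A_0 is essentially selfadjoint, any sequence in A_* converging together with its
    G0-values can be corrected, first by elements of A_0 and then by a vanishing solution of the
    boundary problem, into a sequence of eigenvectors; hence dom cl gamma(l) = ran cl G0 for
    every l.  That M is in R^s holds for every unitary triple: solvability gives maximality and
    the adjoint relation, and (M(z) + mu)^-1 is holomorphic by the resolvent identity

      ((M(z) + mu)^-1 h, k) = (h, G0 e) - (z - w) (f_z, e),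

    with f_z and e the solutions for (z, mu, h) and (conj w, conj mu, k). *)
Require Import Defs.
From Stdlib Require Import Reals Lra Lia Psatz Classical ClassicalEpsilon Cantor.
From Coquelicot Require Import Coquelicot.
Set Implicit Arguments.
Open Scope R_scope.

Lemma C_eq_parts (a b : C) : Re a = Re b -> Im a = Im b -> a = b.
Proof. destruct a, b; simpl; congruence. Qed.

Lemma im_le_Cmod (c : C) : Rabs (Im c) <= Cmod c.
Proof. eapply Rle_trans; [apply Rmax_r | apply Rmax_Cmod]. Qed.

Ltac cplx := unfold Re, Im in *; simpl in *.

(** * Hilbert spaces *)

Section InnerProduct.
Context {H : hilbert}.
Implicit Types x y z : H.

Lemma ip_addr x y z : ip z (plus x y) = Cplus (ip z x) (ip z y).
Proof. rewrite (ip_sym H _ z), ip_addl, Cplus_conj, <- !ip_sym; reflexivity. Qed.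

Lemma ip_scalr (a : C) x y : ip x (scal a y) = Cmult (Cconj a) (ip x y).
Proof. rewrite (ip_sym H _ x), ip_scall, Cmult_conj, <- ip_sym; reflexivity. Qed.

Lemma ip_oppl x y : ip (opp x) y = Copp (ip x y).
Proof. rewrite <- scal_opp_one, ip_scall. change (opp one) with (Copp 1). ring. Qed.

Lemma ip_oppr x y : ip x (opp y) = Copp (ip x y).
Proof. rewrite (ip_sym H _ x), ip_oppl, Copp_conj, <- ip_sym; reflexivity. Qed.

Lemma ip_zerol x : ip zero x = RtoC 0.
Proof.
  assert (E : ip (plus zero zero) x = ip zero x) by (rewrite plus_zero_l; reflexivity).
  rewrite ip_addl in E.
  replace (ip zero x) with (Cminus (Cplus (ip zero x) (ip zero x)) (ip zero x)) by ring.
  rewrite E. ring.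
Qed.

Lemma ip_zeror x : ip x zero = RtoC 0.
Proof. rewrite (ip_sym H _ x), ip_zerol. apply C_eq_parts; simpl; ring. Qed.

Lemma ip_minusl x y z : ip (minus x y) z = Cminus (ip x z) (ip y z).
Proof. unfold minus. rewrite ip_addl, ip_oppl. ring. Qed.

Lemma ip_minusr x y z : ip x (minus y z) = Cminus (ip x y) (ip x z).
Proof. unfold minus. rewrite ip_addr, ip_oppr. ring. Qed.

(* Next to a [minus], [zero] and [plus] are elaborated in this monoid, convertible to but
   not syntactically [ModuleSpace.AbelianMonoid], and rewriting tells them apart. *)
Local Notation group_monoid := (AbelianMonoid.Pack (ModuleSpace.AbelianGroup C_Ring H)
  (AbelianGroup.base (ModuleSpace.AbelianGroup C_Ring H)
    (AbelianGroup.class (ModuleSpace.AbelianGroup C_Ring H)))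
  (ModuleSpace.AbelianGroup C_Ring H)).

Lemma ip_group_zerol x : ip (@zero group_monoid) x = RtoC 0.
Proof. apply ip_zerol. Qed.

Lemma ip_group_zeror x : ip x (@zero group_monoid) = RtoC 0.
Proof. apply ip_zeror. Qed.

Lemma ip_group_addl x y z :
  ip (@plus group_monoid x y) z = Cplus (ip x z) (ip y z).
Proof. apply ip_addl. Qed.

Lemma ip_group_addr x y z :
  ip z (@plus group_monoid x y) = Cplus (ip z x) (ip z y).
Proof. apply ip_addr. Qed.

End InnerProduct.

Ltac ip_expand :=
  repeat first [ rewrite ip_minusl | rewrite ip_minusr | rewrite ip_addl | rewrite ip_addr
   | rewrite ip_scall | rewrite ip_scalr | rewrite ip_oppl | rewrite ip_oppr
   | rewrite ip_zerol | rewrite ip_zeror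
   | rewrite ip_group_zerol | rewrite ip_group_zeror
   | rewrite ip_group_addl | rewrite ip_group_addr ].

(** * Norm and the Cauchy-Schwarz inequality *)

Section Norm.
Context {H : hilbert}.
Implicit Types x y z : H.

Lemma ip_self_re x : Re (ip x x) = hnorm x ^ 2.
Proof. unfold hnorm, ipn. rewrite pow2_sqrt; [reflexivity | apply ip_pos]. Qed.

Lemma ip_self_im x : Im (ip x x) = 0.
Proof. pose proof (f_equal Im (ip_sym H x x)) as E. rewrite im_conj in E. lra. Qed.

Lemma ip_self x : ip x x = RtoC (hnorm x ^ 2).
Proof. apply C_eq_parts; [apply ip_self_re | apply ip_self_im]. Qed.

Lemma ip_re_sym x y : Re (ip y x) = Re (ip x y).
Proof. rewrite (ip_sym H x y). apply re_conj. Qed.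

Lemma ip_im_sym x y : Im (ip y x) = - Im (ip x y).
Proof. rewrite (ip_sym H x y). apply im_conj. Qed.

Lemma hnorm_ge0 x : 0 <= hnorm x.
Proof. apply sqrt_pos. Qed.

Lemma hnorm_eq0 x : hnorm x = 0 -> x = zero.
Proof. intro E. apply ip_def. rewrite ip_self, E. f_equal. ring. Qed.

Lemma hnorm_zero : hnorm (@zero H) = 0.
Proof. unfold hnorm, ipn. rewrite ip_zerol. apply sqrt_0. Qed.

Lemma hnorm_unique x r : 0 <= r -> Re (ip x x) = r ^ 2 -> hnorm x = r.
Proof. intros Hr E. unfold hnorm, ipn. rewrite E. apply sqrt_pow2, Hr. Qed.

Lemma hnorm_opp x : hnorm (opp x) = hnorm x.
Proof. apply hnorm_unique; [apply hnorm_ge0|]. ip_expand. rewrite <- ip_self_re. cplx. ring. Qed.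

Lemma hnorm_scal (a : C) x : hnorm (scal a x) = Cmod a * hnorm x.
Proof.
  apply hnorm_unique; [apply Rmult_le_pos; [apply Cmod_ge_0 | apply hnorm_ge0]|].
  ip_expand. rewrite ip_self, Rpow_mult_distr, Cmod2_alt. destruct a; simpl. ring.
Qed.

Lemma minus_eq0 x y : minus x y = zero -> x = y.
Proof. intro Z. apply (plus_reg_r (opp y)). rewrite plus_opp_r. exact Z. Qed.

(** Testing against vectors turns linear identities in the space into identities of complex numbers;
    the tactic [vec] relies on it to close them by [ring]. *)
Lemma vec_ext x y : (forall z, ip x z = ip y z) -> x = y.
Proof. intro E. apply minus_eq0, ip_def. rewrite ip_minusl, E. ring. Qed.

(** Expand 0 <= | |y| x - |x| y |^2 and divide by 2 |x| |y|; the degenerate cases are treated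
    first. *)
Lemma ip_re_le x y : Re (ip x y) <= hnorm x * hnorm y.
Proof.
  pose proof (hnorm_ge0 x) as Hx; pose proof (hnorm_ge0 y) as Hy.
  destruct (Req_dec (hnorm x) 0) as [Ex|Nx].
  { rewrite (hnorm_eq0 x Ex), ip_zerol, hnorm_zero. simpl. lra. }
  destruct (Req_dec (hnorm y) 0) as [Ey|Ny].
  { rewrite (hnorm_eq0 y Ey), ip_zeror, hnorm_zero. simpl. lra. }
  pose proof (ip_pos H (minus (scal (RtoC (hnorm y)) x) (scal (RtoC (hnorm x)) y))) as P.
  revert P. ip_expand. rewrite !ip_self. intro P.
  pose proof (ip_re_sym x y) as S.
  assert (0 < hnorm x * hnorm y) by (apply Rmult_lt_0_compat; lra).
  apply (Rmult_le_reg_l (hnorm x * hnorm y)); [assumption|]. cplx. rewrite S in P. nra.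
Qed.

(** Multiplying x by the conjugate of (x, y) makes the inner product equal to |(x, y)|^2, so the
    bound on real parts applies; then divide by |(x, y)|. *)
Lemma ip_cauchy_schwarz x y : Cmod (ip x y) <= hnorm x * hnorm y.
Proof.
  pose proof (hnorm_ge0 x) as Hx; pose proof (hnorm_ge0 y) as Hy.
  destruct (Req_dec (Cmod (ip x y)) 0) as [E|N].
  { rewrite E. nra. }
  pose proof (ip_re_le (scal (Cconj (ip x y)) x) y) as P.
  rewrite ip_scall, hnorm_scal, Cmod_conj in P.
  pose proof (Cmod_ge_0 (ip x y)).
  replace (Re (Cconj (ip x y) * ip x y)%C) with (Cmod (ip x y) ^ 2) in P.
  2:{ rewrite Cmod2_alt. destruct (ip x y); simpl; ring. }
  apply (Rmult_le_reg_l (Cmod (ip x y))); nra.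
Qed.

Lemma hnorm_plus x y : hnorm (plus x y) <= hnorm x + hnorm y.
Proof.
  pose proof (hnorm_ge0 x); pose proof (hnorm_ge0 y).
  apply Rsqr_incr_0; try (apply hnorm_ge0 || lra).
  rewrite !Rsqr_pow2, <- ip_self_re. ip_expand. rewrite !ip_self.
  pose proof (ip_re_le x y). pose proof (ip_re_sym x y). cplx. nra.
Qed.

Lemma hnorm_minus_diag x : hnorm (minus x x) = 0.
Proof. apply hnorm_unique; [lra|]. ip_expand. cplx. ring. Qed.

Lemma hnorm_minus_sym x y : hnorm (minus x y) = hnorm (minus y x).
Proof. rewrite <- (hnorm_opp (minus y x)), opp_minus. reflexivity. Qed.

End Norm.

Ltac vec := apply vec_ext; intro; ip_expand; ring.

Lemma hnorm_triangle {H : hilbert} (x y z : H) :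
  hnorm (minus x z) <= hnorm (minus x y) + hnorm (minus y z).
Proof.
  replace (minus x z) with (plus (minus x y) (minus y z)) by vec. apply hnorm_plus.
Qed.

Lemma inv_INR_lt (eps : R) : 0 < eps ->
  exists N, forall n, (N <= n)%nat -> / (INR n + 1) < eps.
Proof.
  intro He. destruct (archimed_cor1 eps He) as [N [HN HN0]]. exists N. intros n Hn.
  eapply Rlt_trans; [|exact HN].
  apply Rinv_lt_contravar; apply le_INR in Hn; apply lt_INR in HN0; simpl in HN0.
  - nra.
  - lra.
Qed.

Lemma inv_INR_pos n : 0 < / (INR n + 1).
Proof. apply Rinv_0_lt_compat. pose proof (pos_INR n). lra. Qed.

(** * Limits of sequences *)

Section Limits.
Context {H : hilbert}.
Implicit Types u v : nat -> H.

Definition cauchy u := forall eps, 0 < eps -> exists N, forall n m, (N <= n)%nat -> (N <= m)%nat ->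
  hnorm (minus (u n) (u m)) < eps.

Lemma complete u : cauchy u -> exists l, conv u l.
Proof. exact (h_complete H u). Qed.

Lemma conv_cauchy u l : conv u l -> cauchy u.
Proof.
  intros Hu eps He. destruct (Hu (eps / 2)) as [N HN]; [lra|]. exists N. intros n m Hn Hm.
  eapply Rle_lt_trans; [apply (hnorm_triangle _ l)|].
  rewrite (hnorm_minus_sym l). pose proof (HN n Hn); pose proof (HN m Hm). lra.
Qed.

Lemma conv_const (l : H) : conv (fun _ => l) l.
Proof. intros eps He. exists 0%nat. intros. rewrite hnorm_minus_diag. exact He. Qed.

Lemma conv_ext u v l : (forall n, u n = v n) -> conv u l -> conv v l.
Proof. intros E Hu eps He. destruct (Hu eps He) as [N HN]. exists N. intros n Hn. rewrite <- E. auto. Qed.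

Lemma conv_of_rate u l : (forall n, hnorm (minus (u n) l) <= / (INR n + 1)) -> conv u l.
Proof.
  intros Hu eps He. destruct (inv_INR_lt He) as [N HN]. exists N. intros n Hn.
  eapply Rle_lt_trans; [apply Hu | apply HN, Hn].
Qed.

Lemma conv_zero_of_rate c u : (forall n, hnorm (u n) <= c * / (INR n + 1)) -> conv u zero.
Proof.
  intros Hu eps He. destruct (@inv_INR_lt (eps / (Rabs c + 1))) as [N HN].
  { apply Rdiv_lt_0_compat; pose proof (Rabs_pos c); lra. }
  exists N. intros n Hn. replace (minus (u n) (@zero H)) with (u n) by vec.
  specialize (HN n Hn). specialize (Hu n). pose proof (Rabs_pos c). pose proof (Rle_abs c).
  apply Rlt_div_r in HN; [|lra]. pose proof (inv_INR_pos n).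
  assert (c * / (INR n + 1) <= Rabs c * / (INR n + 1)) by (apply Rmult_le_compat_r; lra). lra.
Qed.

Lemma conv_plus u v l m : conv u l -> conv v m -> conv (fun n => plus (u n) (v n)) (plus l m).
Proof.
  intros Hu Hv eps He. destruct (Hu (eps / 2)) as [N HN]; [lra|].
  destruct (Hv (eps / 2)) as [M HM]; [lra|]. exists (N + M)%nat. intros n Hn.
  replace (minus (plus (u n) (v n)) (plus l m))
    with (plus (minus (u n) l) (minus (v n) m)) by vec.
  eapply Rle_lt_trans; [apply hnorm_plus|].
  assert (hnorm (minus (u n) l) < eps / 2) by (apply HN; lia).
  assert (hnorm (minus (v n) m) < eps / 2) by (apply HM; lia). lra.
Qed.

Lemma conv_scal (a : C) u l : conv u l -> conv (fun n => scal a (u n)) (scal a l).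
Proof.
  intros Hu eps He. pose proof (Cmod_ge_0 a) as Ha.
  destruct (Hu (eps / (Cmod a + 1))) as [N HN]; [apply Rdiv_lt_0_compat; lra|].
  exists N. intros n Hn. specialize (HN n Hn).
  replace (minus (scal a (u n)) (scal a l)) with (scal a (minus (u n) l)) by vec.
  rewrite hnorm_scal. pose proof (hnorm_ge0 (minus (u n) l)).
  apply Rlt_div_r in HN; [|lra]. nra.
Qed.

Lemma conv_minus u v l m : conv u l -> conv v m -> conv (fun n => minus (u n) (v n)) (minus l m).
Proof.
  intros Hu Hv. replace (minus l m) with (plus l (scal (Copp 1) m)) by vec.
  apply conv_ext with (fun n => plus (u n) (scal (Copp 1) (v n))).
  - intro. vec.
  - apply conv_plus; [exact Hu | apply conv_scal, Hv].
Qed.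

Lemma conv_ip_eq0 u l y : (forall n, ip y (u n) = RtoC 0) -> conv u l -> ip y l = RtoC 0.
Proof.
  intros E Hu. apply Cmod_eq_0, Rle_antisym; [|apply Cmod_ge_0].
  apply le_epsilon. intros eps He. rewrite Rplus_0_l. pose proof (hnorm_ge0 y) as Hy.
  destruct (Hu (eps / (hnorm y + 1))) as [N HN]; [apply Rdiv_lt_0_compat; lra|].
  specialize (HN N (Nat.le_refl N)).
  assert (Q : ip y l = Copp (ip y (minus (u N) l))). { rewrite ip_minusr, E. ring. }
  rewrite Q, Cmod_opp. pose proof (ip_cauchy_schwarz y (minus (u N) l)).
  apply Rlt_div_r in HN; [|lra]. pose proof (hnorm_ge0 (minus (u N) l)). nra.
Qed.

(** The null sequence u - u converges to l - m, which is therefore orthogonal to itself. *)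
Lemma conv_unique u l m : conv u l -> conv u m -> l = m.
Proof.
  intros Hl Hm. apply minus_eq0, ip_def.
  apply (conv_ip_eq0 (u := fun n => minus (u n) (u n))).
  - intro n. rewrite ip_minusr. ring.
  - apply conv_minus; assumption.
Qed.

End Limits.

Lemma conv_dominated {H K : hilbert} (c : R) (u : nat -> H) (l : H) (v : nat -> K) (m : K) :
  (forall n, hnorm (minus (u n) l) <= c * hnorm (minus (v n) m)) -> conv v m -> conv u l.
Proof.
  intros Hd Hv eps He.
  destruct (Hv (eps / (Rabs c + 1))) as [N HN].
  { apply Rdiv_lt_0_compat; pose proof (Rabs_pos c); lra. }
  exists N. intros n Hn. specialize (HN n Hn). pose proof (Rabs_pos c). pose proof (Rle_abs c).
  apply Rlt_div_r in HN; [|lra]. specialize (Hd n). pose proof (hnorm_ge0 (minus (v n) m)). nra.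
Qed.

Lemma cauchy_dominated {H K : hilbert} (c : R) (u : nat -> H) (v : nat -> K) :
  (forall n m, hnorm (minus (u n) (u m)) <= c * hnorm (minus (v n) (v m))) -> cauchy v -> cauchy u.
Proof.
  intros Hd Hv eps He.
  destruct (Hv (eps / (Rabs c + 1))) as [N HN].
  { apply Rdiv_lt_0_compat; pose proof (Rabs_pos c); lra. }
  exists N. intros n m Hn Hm. specialize (HN n m Hn Hm).
  pose proof (Rabs_pos c). pose proof (Rle_abs c).
  apply Rlt_div_r in HN; [|lra]. specialize (Hd n m).
  pose proof (hnorm_ge0 (minus (v n) (v m))). nra.
Qed.

(** * The Hilbert space of pairs *)

Section Product.
Variables H K : hilbert.

Definition pair_ip (x y : prod_ModuleSpace C_Ring H K) : C :=
  Cplus (ip (fst x) (fst y)) (ip (snd x) (snd y)).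

Lemma ipn_pair_sqr x : ipn pair_ip x ^ 2 = hnorm (fst x) ^ 2 + hnorm (snd x) ^ 2.
Proof.
  unfold ipn. rewrite pow2_sqrt; unfold pair_ip; rewrite ?ip_self; cplx; nra.
Qed.

Lemma ipn_pair_ge0 x : 0 <= ipn pair_ip x.
Proof. apply sqrt_pos. Qed.

Lemma hnorm_fst_le x : hnorm (fst x) <= ipn pair_ip x.
Proof.
  apply Rsqr_incr_0; [|apply hnorm_ge0|apply ipn_pair_ge0].
  rewrite !Rsqr_pow2, ipn_pair_sqr. nra.
Qed.

Lemma hnorm_snd_le x : hnorm (snd x) <= ipn pair_ip x.
Proof.
  apply Rsqr_incr_0; [|apply hnorm_ge0|apply ipn_pair_ge0].
  rewrite !Rsqr_pow2, ipn_pair_sqr. nra.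
Qed.

Lemma ipn_pair_le x : ipn pair_ip x <= hnorm (fst x) + hnorm (snd x).
Proof.
  pose proof (hnorm_ge0 (fst x)); pose proof (hnorm_ge0 (snd x)).
  apply Rsqr_incr_0; [|apply ipn_pair_ge0|lra].
  rewrite !Rsqr_pow2, ipn_pair_sqr. nra.
Qed.

Lemma pair_complete (u : nat -> prod_ModuleSpace C_Ring H K) :
  (forall eps, 0 < eps -> exists N, forall n m, (N <= n)%nat -> (N <= m)%nat ->
    ipn pair_ip (minus (u n) (u m)) < eps) ->
  exists l, forall eps, 0 < eps -> exists N, forall n, (N <= n)%nat ->
    ipn pair_ip (minus (u n) l) < eps.
Proof.
  intro Hu.
  destruct (@complete H (fun n => fst (u n))) as [l Hl].
  { intros eps He. destruct (Hu eps He) as [N HN]. exists N. intros n m Hn Hm.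
    eapply Rle_lt_trans; [apply (hnorm_fst_le (minus (u n) (u m))) | auto]. }
  destruct (@complete K (fun n => snd (u n))) as [m Hm].
  { intros eps He. destruct (Hu eps He) as [N HN]. exists N. intros n m Hn Hm.
    eapply Rle_lt_trans; [apply (hnorm_snd_le (minus (u n) (u m))) | auto]. }
  exists (l, m). intros eps He.
  destruct (Hl (eps / 2)) as [N HN]; [lra|]. destruct (Hm (eps / 2)) as [M HM]; [lra|].
  exists (N + M)%nat. intros n Hn.
  eapply Rle_lt_trans; [apply ipn_pair_le|].
  assert (hnorm (minus (fst (u n)) l) < eps / 2) by (apply HN; lia).
  assert (hnorm (minus (snd (u n)) m) < eps / 2) by (apply HM; lia).
  change (hnorm (minus (fst (u n)) l) + hnorm (minus (snd (u n)) m) < eps). lra.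
Qed.

Lemma pair_separable : exists d : nat -> prod_ModuleSpace C_Ring H K,
  forall x eps, 0 < eps -> exists n, ipn pair_ip (minus x (d n)) < eps.
Proof.
  destruct (h_separable H) as [d1 H1]. destruct (h_separable K) as [d2 H2].
  exists (fun n => (d1 (fst (Cantor.of_nat n)), d2 (snd (Cantor.of_nat n)))).
  intros x eps He.
  destruct (H1 (fst x) (eps / 2)) as [n Hn]; [lra|].
  destruct (H2 (snd x) (eps / 2)) as [m Hm]; [lra|].
  exists (Cantor.to_nat (n, m)). rewrite Cantor.cancel_of_to.
  eapply Rle_lt_trans; [apply ipn_pair_le|].
  change (ipn (@ip H) (minus (fst x) (d1 n)) + ipn (@ip K) (minus (snd x) (d2 m)) < eps). lra.
Qed.

(** Graphs and boundary data become subspaces of a single Hilbert space, to which the projection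
    theorem applies. The definition stays transparent so that the inner product of pairs unfolds by
    conversion. *)
Definition hprod : hilbert.
Proof.
  refine (@Hilbert (prod_ModuleSpace C_Ring H K) pair_ip _ _ _ _ _ pair_complete pair_separable).
  - intros [x x'] [y y'] [z z']. unfold pair_ip. simpl.
    change (Cplus (ip (plus x y) z) (ip (plus x' y') z')
      = Cplus (Cplus (ip x z) (ip x' z')) (Cplus (ip y z) (ip y' z'))).
    ip_expand. ring.
  - intros a [x x'] [y y'].
    change (Cplus (ip (scal a x) y) (ip (scal a x') y') = Cmult a (Cplus (ip x y) (ip x' y'))).
    ip_expand. ring.
  - intros x y. unfold pair_ip.
    rewrite Cplus_conj, <- !ip_sym. reflexivity.
  - intro x. unfold pair_ip. pose proof (ip_pos H (fst x)). pose proof (ip_pos K (snd x)).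
    cplx. lra.
  - intros [x x'] E. unfold pair_ip in E. simpl in E. rewrite !ip_self in E.
    apply (f_equal Re) in E. cplx.
    rewrite (hnorm_eq0 x), (hnorm_eq0 x'); [reflexivity | nra | nra].
Defined.

Lemma hnorm_pair_sqr (x : H) (y : K) :
  hnorm ((x, y) : hprod) ^ 2 = hnorm x ^ 2 + hnorm y ^ 2.
Proof. exact (ipn_pair_sqr (x, y)). Qed.

Lemma hnorm_fst_pair (x : H) (y : K) : hnorm x <= hnorm ((x, y) : hprod).
Proof. exact (hnorm_fst_le (x, y)). Qed.

Lemma hnorm_snd_pair (x : H) (y : K) : hnorm y <= hnorm ((x, y) : hprod).
Proof. exact (hnorm_snd_le (x, y)). Qed.

Lemma hnorm_pair_le (x : H) (y : K) : hnorm ((x, y) : hprod) <= hnorm x + hnorm y.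
Proof. exact (ipn_pair_le (x, y)). Qed.

Lemma conv_pair (u : nat -> H) (v : nat -> K) l m :
  conv u l -> conv v m -> @conv hprod (fun n => (u n, v n)) (l, m).
Proof.
  intros Hl Hm eps He.
  destruct (Hl (eps / 2)) as [N HN]; [lra|]. destruct (Hm (eps / 2)) as [M HM]; [lra|].
  exists (N + M)%nat. intros n Hn.
  eapply Rle_lt_trans; [apply ipn_pair_le|].
  assert (hnorm (minus (u n) l) < eps / 2) by (apply HN; lia).
  assert (hnorm (minus (v n) m) < eps / 2) by (apply HM; lia).
  change (hnorm (minus (u n) l) + hnorm (minus (v n) m) < eps). lra.
Qed.

Lemma conv_fst (u : nat -> hprod) (p : hprod) : conv u p -> conv (fun n => fst (u n)) (fst p).
Proof.
  intro Hu. apply (@conv_dominated _ _ 1 _ _ u p); [|exact Hu].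
  intro n. rewrite Rmult_1_l. apply (hnorm_fst_le (minus (u n) p)).
Qed.

Lemma conv_snd (u : nat -> hprod) (p : hprod) : conv u p -> conv (fun n => snd (u n)) (snd p).
Proof.
  intro Hu. apply (@conv_dominated _ _ 1 _ _ u p); [|exact Hu].
  intro n. rewrite Rmult_1_l. apply (hnorm_snd_le (minus (u n) p)).
Qed.

End Product.

(** * Orthogonal projection onto the closure of a subspace *)

Section Projection.
Variables (H : hilbert) (P : H -> Prop).
Hypothesis P_zero : P zero.
Hypothesis P_plus : forall x y, P x -> P y -> P (plus x y).
Hypothesis P_scal : forall (a : C) x, P x -> P (scal a x).

Lemma minimizing_sequence (x : H) : exists (d : R) (p : nat -> H), 0 <= d /\
  (forall q, P q -> d <= hnorm (minus x q)) /\
  forall n, P (p n) /\ hnorm (minus x (p n)) <= d + / (INR n + 1).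
Proof.
  (* [completeness] yields suprema, so the distance from x to P is obtained as minus the supremum of
     the negated norms. *)
  set (E := fun r => exists q, P q /\ r = - hnorm (minus x q)).
  destruct (completeness E) as [s [Hub Hlub]].
  { exists 0. intros r [q [_ ->]]. pose proof (hnorm_ge0 (minus x q)). lra. }
  { exists (- hnorm (minus x zero)), zero. auto. }
  assert (Hp : forall n, exists q, P q /\ hnorm (minus x q) <= - s + / (INR n + 1)).
  { intro n. apply NNPP. intro Hn. pose proof (inv_INR_pos n).
    enough (s <= s - / (INR n + 1)) by lra. apply Hlub. intros r [q [Hq ->]].
    destruct (Rle_lt_dec (hnorm (minus x q)) (- s + / (INR n + 1))); [|lra].
    exfalso. eauto. }
  exists (- s), (fun n => proj1_sig (constructive_indefinite_description _ (Hp n))).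
  split; [|split].
  - enough (s <= 0) by lra. apply Hlub. intros r [q [_ ->]].
    pose proof (hnorm_ge0 (minus x q)). lra.
  - intros q Hq. enough (- hnorm (minus x q) <= s) by lra. apply Hub. exists q. auto.
  - intro n. exact (proj2_sig (constructive_indefinite_description _ (Hp n))).
Qed.

Lemma parallelogram (x p q : H) :
  hnorm (minus p q) ^ 2 = 2 * hnorm (minus x p) ^ 2 + 2 * hnorm (minus x q) ^ 2
    - 4 * hnorm (minus x (scal (RtoC (/ 2)) (plus p q))) ^ 2.
Proof.
  rewrite <- !ip_self_re. ip_expand. cplx. field.
Qed.

(** The parallelogram law makes a minimizing sequence Cauchy, and the first variation at its limit
    gives orthogonality. The limit lies in the closure of [P], so it comes with a sequence from
    [P]. *)
Theorem projection (x : H) : exists (p : nat -> H) (l : H),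
  (forall n, P (p n)) /\ conv p l /\ forall q, P q -> ip q (minus x l) = RtoC 0.
Proof.
  destruct (minimizing_sequence x) as (d & p & Hd & Hmin & Hp).
  assert (Hc : cauchy p).
  { intros eps He.
    (* If both distances are at most d + k with 0 < k <= 1, the parallelogram law bounds |p n - p
       m|^2 by 4 (d + k)^2 - 4 d^2 <= k (8 d + 4) < k (8 d + 5). *)
    assert (Hk : 0 < Rmin 1 (eps ^ 2 / (8 * d + 5))).
    { apply Rmin_glb_lt; [lra|]. apply Rdiv_lt_0_compat; nra. }
    destruct (inv_INR_lt Hk) as [N HN]. exists N. intros n m Hn Hm.
    set (k := Rmin 1 (eps ^ 2 / (8 * d + 5))) in *.
    assert (Hk1 : k <= 1) by apply Rmin_l.
    assert (Hk2 : k * (8 * d + 5) <= eps ^ 2).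
    { apply Rle_div_r; [lra|]. apply Rmin_r. }
    destruct (Hp n) as [Pn Bn]. destruct (Hp m) as [Pm Bm].
    pose proof (HN n Hn). pose proof (HN m Hm).
    assert (d <= hnorm (minus x (scal (RtoC (/ 2)) (plus (p n) (p m))))) by auto.
    pose proof (parallelogram x (p n) (p m)) as E.
    pose proof (hnorm_ge0 (minus x (p n))). pose proof (hnorm_ge0 (minus x (p m))).
    assert (hnorm (minus x (p n)) ^ 2 <= (d + k) ^ 2) by (apply pow_incr; lra).
    assert (hnorm (minus x (p m)) ^ 2 <= (d + k) ^ 2) by (apply pow_incr; lra).
    assert (d ^ 2 <= hnorm (minus x (scal (RtoC (/ 2)) (plus (p n) (p m)))) ^ 2)
      by (apply pow_incr; lra).
    apply Rsqr_incrst_0; [|apply hnorm_ge0|lra]. rewrite !Rsqr_pow2. nra. }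
  destruct (complete Hc) as [l Hl]. exists p, l. split; [apply Hp | split; [exact Hl|]].
  (* l + q is a limit of the points p N + q of [P], so it inherits their lower bound d. *)
  assert (Hfar : forall q, P q -> d <= hnorm (minus x (plus l q))).
  { intros q Hq. apply le_epsilon. intros eps He. destruct (Hl eps He) as [N HN].
    specialize (HN N (Nat.le_refl N)).
    eapply Rle_trans; [apply (Hmin (plus (p N) q)); apply P_plus; [apply Hp | exact Hq]|].
    replace (minus x (plus (p N) q)) with (minus (minus x (plus l q)) (minus (p N) l)) by vec.
    unfold minus at 1. eapply Rle_trans; [apply hnorm_plus|]. rewrite hnorm_opp. lra. }
  assert (Hnear : hnorm (minus x l) <= d).
  { apply le_epsilon. intros eps He. destruct (Hl (eps / 2)) as [N HN]; [lra|].
    destruct (inv_INR_lt (eps := eps / 2)) as [N' HN']; [lra|].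
    specialize (HN (N + N')%nat ltac:(lia)). specialize (HN' (N + N')%nat ltac:(lia)).
    eapply Rle_trans; [apply (hnorm_triangle _ (p (N + N')%nat))|].
    destruct (Hp (N + N')%nat). lra. }
  intros q Hq. set (y := minus x l). set (c := ip q y).
  set (s := / (hnorm q ^ 2 + 1)).
  assert (Hs : s * (hnorm q ^ 2 + 1) = 1).
  { unfold s. apply Rinv_l. pose proof (pow2_ge_0 (hnorm q)). lra. }
  (* Compare y with y - s c* q; s is small enough for the first-order gain to win. *)
  assert (F : hnorm y ^ 2 <= hnorm (minus y (scal (Cmult (RtoC s) (Cconj c)) q)) ^ 2).
  { apply pow_incr. split; [apply hnorm_ge0|].
    apply Rle_trans with (1 := Hnear).
    replace (minus y (scal (Cmult (RtoC s) (Cconj c)) q))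
      with (minus x (plus l (scal (Cmult (RtoC s) (Cconj c)) q))) by (unfold y; vec).
    apply Hfar, P_scal, Hq. }
  rewrite <- !ip_self_re in F. revert F. ip_expand. rewrite (ip_sym H q y), !ip_self. fold c.
  intro F. assert (Hs0 : 0 < s).
  { apply Rinv_0_lt_compat. pose proof (pow2_ge_0 (hnorm q)). lra. }
  assert (Z : Cmod c ^ 2 <= 0).
  { rewrite Cmod2_alt. destruct c as [a b]. cplx.
    (* This is [F] after cancellation; its last factor is below -1, which forces c = 0. *)
    assert (G : 0 <= s * (a * a + b * b) * (-2 + s * (hnorm q * hnorm q))) by nra.
    assert (s * (hnorm q * hnorm q) < 1) by nra.
    apply Rnot_lt_le. intro A. assert (0 < s * (a * a + b * b)) by nra. nra. }
  apply Cmod_eq_0. pose proof (Cmod_ge_0 c). nra.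
Qed.

End Projection.

(** * Linear relations *)

Section Closure.
Context {X Y : hilbert}.
Variable T : rel X Y.

Lemma rclosure_incl x y : T x y -> rclosure T x y.
Proof. intro E. exists (fun _ => x), (fun _ => y). split; [auto | split; apply conv_const]. Qed.

(** Choosing approximants at distance below 1/(n+1) produces the sequences required by [rclosure];
    iterated closures can then be handled with epsilons. *)
Lemma rclosure_approx x y :
  (forall eps, 0 < eps -> exists x' y', T x' y' /\ hnorm (minus x' x) < eps /\ hnorm (minus y' y) < eps) ->
  rclosure T x y.
Proof.
  intro Ha.
  assert (Hp : forall n, exists p, T (fst p) (snd p) /\
    hnorm (minus (fst p) x) < / (INR n + 1) /\ hnorm (minus (snd p) y) < / (INR n + 1)).
  { intro n. destruct (Ha _ (inv_INR_pos n)) as (x' & y' & E). exists (x', y'). exact E. }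
  set (p := fun n => proj1_sig (constructive_indefinite_description _ (Hp n))).
  assert (Q : forall n, T (fst (p n)) (snd (p n)) /\
    hnorm (minus (fst (p n)) x) < / (INR n + 1) /\ hnorm (minus (snd (p n)) y) < / (INR n + 1)).
  { intro n. exact (proj2_sig (constructive_indefinite_description _ (Hp n))). }
  exists (fun n => fst (p n)), (fun n => snd (p n)). split; [apply Q|].
  split; apply conv_of_rate; intro n; apply Rlt_le, Q.
Qed.

Lemma rclosure_closed : rclosed (rclosure T).
Proof.
  intros x y (u & v & E & Hu & Hv). apply rclosure_approx. intros eps He.
  destruct (Hu (eps / 2)) as [N HN]; [lra|]. destruct (Hv (eps / 2)) as [M HM]; [lra|].
  destruct (E (N + M)%nat) as (u' & v' & E' & Hu' & Hv').
  destruct (Hu' (eps / 2)) as [N' HN']; [lra|]. destruct (Hv' (eps / 2)) as [M' HM']; [lra|].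
  exists (u' (N' + M')%nat), (v' (N' + M')%nat). split; [auto|]. split.
  - eapply Rle_lt_trans; [apply (hnorm_triangle _ (u (N + M)%nat))|].
    pose proof (HN (N + M)%nat ltac:(lia)). pose proof (HN' (N' + M')%nat ltac:(lia)). lra.
  - eapply Rle_lt_trans; [apply (hnorm_triangle _ (v (N + M)%nat))|].
    pose proof (HM (N + M)%nat ltac:(lia)). pose proof (HM' (N' + M')%nat ltac:(lia)). lra.
Qed.

Lemma rclosure_subspace : subspace T -> subspace (rclosure T).
Proof.
  intros (T0 & Tp & Ts). split; [apply rclosure_incl, T0|]. split.
  - intros x y x' y' (u & v & E & Hu & Hv) (u' & v' & E' & Hu' & Hv').
    exists (fun n => plus (u n) (u' n)), (fun n => plus (v n) (v' n)).
    split; [auto | split; apply conv_plus; assumption].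
  - intros a x y (u & v & E & Hu & Hv).
    exists (fun n => scal a (u n)), (fun n => scal a (v n)).
    split; [auto | split; apply conv_scal; assumption].
Qed.

Lemma subspace_minus x y x' y' : subspace T -> T x y -> T x' y' -> T (minus x x') (minus y y').
Proof.
  intros (_ & Tp & Ts) E E'.
  replace (minus x x') with (plus x (scal (Copp 1) x')) by vec.
  replace (minus y y') with (plus y (scal (Copp 1) y')) by vec. auto.
Qed.

Lemma operator_unique x y y' : subspace T -> is_operator T -> T x y -> T x y' -> y = y'.
Proof.
  intros Hs Ho E E'. apply minus_eq0, Ho.
  pose proof (subspace_minus Hs E E') as D.
  replace (minus x x) with (@zero X) in D by vec. exact D.
Qed.

End Closure.

(** The pair (x, -y) is orthogonal to every (u n, v n), hence to the limit. This is how identities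
    of Green type pass to closures. *)
Lemma conv_ip_eq {H K : hilbert} (u : nat -> H) (v : nat -> K) l m x y :
  (forall n, ip x (u n) = ip y (v n)) -> conv u l -> conv v m -> ip x l = ip y m.
Proof.
  intros E Hu Hv.
  assert (Z : ip ((x, opp y) : hprod H K) ((l, m) : hprod H K) = RtoC 0).
  { apply (@conv_ip_eq0 (hprod H K) (fun n => (u n, v n))).
    - intro n. change (Cplus (ip x (u n)) (ip (opp y) (v n)) = RtoC 0).
      rewrite ip_oppl, E. ring.
    - apply conv_pair; assumption. }
  change (Cplus (ip x l) (ip (opp y) m) = RtoC 0) in Z. rewrite ip_oppl in Z.
  replace (ip x l) with (Cplus (Cplus (ip x l) (Copp (ip y m))) (ip y m)) by ring.
  rewrite Z. ring.
Qed.

Lemma ip_eq_sym {H K : hilbert} (x x' : H) (y y' : K) : ip x x' = ip y y' -> ip x' x = ip y' y.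
Proof. intro E. rewrite (ip_sym H x x'), (ip_sym K y y'), E. reflexivity. Qed.

(** * Symmetric relations and essential selfadjointness *)

Section Symmetric.
Context {H : hilbert}.
Variable T : rel H H.

Lemma radjoint_rclosure g g' f f' : radjoint T g g' -> rclosure T f f' -> ip f' g = ip f g'.
Proof.
  intros Hg (u & v & E & Hu & Hv). apply ip_eq_sym.
  apply (conv_ip_eq (u := v) (v := u)); [|assumption..]. intro n. apply ip_eq_sym, Hg, E.
Qed.

Lemma symmetric_rclosure f f' : symmetric T -> rclosure T f f' -> radjoint T f f'.
Proof.
  intros Hs E g g' Eg. apply ip_eq_sym, eq_sym.
  apply radjoint_rclosure; [apply Hs, Eg | exact E].
Qed.

(** Symmetry makes (f', f) real, so |Im (f' - z f, f)| = |Im z| |f|^2; conclude by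
    Cauchy-Schwarz. *)
Lemma symmetric_lower_bound (z : C) f f' : symmetric T -> T f f' ->
  Rabs (Im z) * hnorm f <= hnorm (minus f' (scal z f)).
Proof.
  intros Hs E. pose proof (hnorm_ge0 f) as Hf.
  destruct (Req_dec (hnorm f) 0) as [Z|NZ].
  { rewrite Z, Rmult_0_r. apply hnorm_ge0. }
  apply (Rmult_le_reg_r (hnorm f)); [lra|].
  eapply Rle_trans; [|apply ip_cauchy_schwarz].
  eapply Rle_trans; [|apply im_le_Cmod].
  ip_expand. rewrite ip_self.
  pose proof (Hs _ _ E _ _ E) as S. pose proof (f_equal Im S) as S'. rewrite ip_im_sym in S'.
  right. rewrite Rmult_assoc, <- (Rabs_pos_eq (hnorm f * hnorm f)) by nra.
  rewrite <- Rabs_mult, <- Rabs_Ropp. f_equal. cplx. rewrite S. lra.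
Qed.

(** Density of ran (T - z), expressed as triviality of its orthogonal complement, the eigenspace of
    the adjoint of T at conj z. *)
Definition total_range (z : C) : Prop :=
  forall y, (forall f f', T f f' -> ip (minus f' (scal z f)) y = RtoC 0) -> y = zero.

Lemma total_range_dense (z : C) (r : H) : subspace T -> total_range z ->
  exists a a' : nat -> H, (forall n, T (a n) (a' n)) /\
    conv (fun n => minus (a' n) (scal z (a n))) r.
Proof.
  intros (T0 & Tp & Ts) Ht.
  destruct (@projection H (fun q => exists f f', T f f' /\ q = minus f' (scal z f))) with (x := r)
    as (p & l & Hp & Hl & Ho).
  - exists zero, zero. split; [exact T0 | vec].
  - intros x y (f & f' & E & ->) (g & g' & E' & ->).
    exists (plus f g), (plus f' g'). split; [auto | vec].
  - intros a x (f & f' & E & ->). exists (scal a f), (scal a f'). split; [auto | vec].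
  - assert (Z : minus r l = zero).
    { apply Ht. intros f f' E. apply Ho. exists f, f'. auto. }
    apply minus_eq0 in Z. subst l.
    assert (Hp' : forall n, exists q, T (fst q) (snd q) /\ p n = minus (snd q) (scal z (fst q))).
    { intro n. destruct (Hp n) as (f & f' & E). exists (f, f'). exact E. }
    set (q := fun n => proj1_sig (constructive_indefinite_description _ (Hp' n))).
    assert (Q : forall n, T (fst (q n)) (snd (q n)) /\ p n = minus (snd (q n)) (scal z (fst (q n)))).
    { intro n. exact (proj2_sig (constructive_indefinite_description _ (Hp' n))). }
    exists (fun n => fst (q n)), (fun n => snd (q n)). split; [apply Q|].
    apply conv_ext with p; [apply Q | exact Hl].
Qed.

Lemma eigenvector_symmetric (w : C) (y : H) :
  Im w <> 0 -> ip (scal w y) y = ip y (scal w y) -> y = zero.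
Proof.
  intros Hw E. apply (f_equal Im) in E. revert E. ip_expand. rewrite ip_self. intro E.
  apply hnorm_eq0. pose proof (hnorm_ge0 y). cplx.
  assert (Z : snd w * (hnorm y * hnorm y) = 0) by nra.
  apply Rmult_integral in Z. destruct Z as [Z|Z]; [contradiction | nra].
Qed.

(** A vector y orthogonal to the range gives the element (y, conj z y) of the adjoint, hence of the
    closure, which is symmetric and has no nonreal eigenvalue. *)
Lemma ess_selfadjoint_total (z : C) : ess_selfadjoint T -> Im z <> 0 -> total_range z.
Proof.
  intros He Hz y Hy. apply (@eigenvector_symmetric (Cconj z)); [rewrite im_conj; lra|].
  assert (Ha : radjoint T y (scal (Cconj z) y)).
  { intros f f' E. specialize (Hy f f' E). revert Hy. ip_expand. rewrite Cconj_conj. intro Hy.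
    replace (ip f' y) with (Cplus (Cminus (ip f' y) (Cmult z (ip f y))) (Cmult z (ip f y))) by ring.
    rewrite Hy. ring. }
  apply radjoint_rclosure; [exact Ha | apply He, Ha].
Qed.

(** Von Neumann's criterion. Density at i and the lower bound yield, for (g, g') in the adjoint, an
    element of the closure with first entry l and the same value of g' - i g. Then g - l is
    orthogonal to ran (T + i), so it vanishes. *)
Lemma total_ess_selfadjoint : subspace T -> symmetric T ->
  total_range Ci -> total_range mCi -> ess_selfadjoint T.
Proof.
  intros Hsub Hs Hi Hmi g g'. split; [apply symmetric_rclosure, Hs|]. intro Hg.
  destruct (@total_range_dense Ci (minus g' (scal Ci g)) Hsub Hi) as (a & a' & E & Hr).
  destruct (@complete H a) as [l Hl].
  { apply (@cauchy_dominated _ _ 1 a (fun n => minus (a' n) (scal Ci (a n)))).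
    - intros n m. rewrite Rmult_1_l.
      pose proof (symmetric_lower_bound Ci Hs (subspace_minus _ _ _ _ Hsub (E n) (E m))) as B.
      simpl in B. rewrite Rabs_R1, Rmult_1_l in B.
      replace (minus (minus (a' n) (scal Ci (a n))) (minus (a' m) (scal Ci (a m))))
        with (minus (minus (a' n) (a' m)) (scal Ci (minus (a n) (a m)))) by vec.
      exact B.
    - eapply conv_cauchy, Hr. }
  assert (Hc : rclosure T l (plus (minus g' (scal Ci g) : H) (scal Ci l))).
  { exists a, a'. split; [exact E | split; [exact Hl|]].
    apply conv_ext with (fun n => plus (minus (a' n) (scal Ci (a n))) (scal Ci (a n))).
    - intro n. vec.
    - apply conv_plus; [exact Hr | apply conv_scal, Hl]. }
  assert (Z : minus g l = zero).
  { apply Hmi. intros f f' Ef. pose proof (symmetric_rclosure Hs Hc Ef) as E1.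
    pose proof (Hg _ _ Ef) as E2. revert E1. ip_expand. rewrite E2. intros ->.
    unfold mCi. ring. }
  apply minus_eq0 in Z. subst l.
  replace g' with (plus (minus g' (scal Ci g)) (scal Ci g)) by vec. exact Hc.
Qed.

End Symmetric.

(** * Forms [G u, G v] and their closures *)

Section GramForm.
Context {K H : hilbert}.
Variable G : rel K H.

(** The closure of [G] as a total function; its value off the domain is arbitrary, and the laws of a
    closed form are required only on the domain. *)
Definition closure_value (u : K) : H := epsilon (inhabits zero) (fun g => rclosure G u g).

Definition gram (u v : K) : C := ip (closure_value u) (closure_value v).

Hypothesis G_sub : subspace G.

(** A sequence converging in the graph of [G] is Cauchy for s, so closedness puts its limit into D
    with convergence in s. At u = 0 this reads |f_n| -> 0, so g = 0. The two conclusions serve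
    minimality of the domain and closability. *)
Lemma closed_form_dom_closure (D : K -> Prop) (s : K -> K -> C) u g :
  closed_nonneg_form D s -> (forall v f, G v f -> D v) ->
  (forall v w f f', G v f -> G w f' -> s v w = ip f f') ->
  rclosure G u g ->
  D u /\ (u = zero -> g = zero).
Proof.
  intros (_ & _ & _ & _ & _ & _ & _ & Hc) HD Hs (un & fn & E & Hu & Hf).
  assert (Hcl : D u /\ forall eps, 0 < eps -> exists N, forall n, (N <= n)%nat ->
        Re (s (minus (un n) u) (minus (un n) u)) < eps).
  { apply Hc; [intro n; apply (HD _ _ (E n)) | exact Hu|]. intros eps He.
    destruct (conv_cauchy Hf (sqrt_lt_R0 _ He)) as [N HN]. exists N. intros n m Hn Hm.
    pose proof (subspace_minus _ _ _ _ G_sub (E n) (E m)) as Em.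
    rewrite (Hs _ _ _ _ Em Em), ip_self_re, <- (pow2_sqrt eps) by lra.
    pose proof (HN n m Hn Hm). pose proof (hnorm_ge0 (minus (fn n) (fn m))).
    pose proof (sqrt_pos eps). nra. }
  destruct Hcl as [Du Hlim]. split; [exact Du|]. intro Z. subst u.
  apply (@conv_unique _ fn); [exact Hf|]. intros eps He.
  destruct (Hlim (eps ^ 2)) as [N HN]; [nra|]. exists N. intros n Hn. specialize (HN n Hn).
  replace (minus (un n) (@zero K)) with (un n) in HN by vec.
  rewrite (Hs _ _ _ _ (E n) (E n)), ip_self_re in HN.
  replace (minus (fn n) (@zero H)) with (fn n) by vec.
  pose proof (hnorm_ge0 (fn n)). nra.
Qed.

Hypothesis G_closable : closable G.

Lemma closure_valueP u g : rclosure G u g -> closure_value u = g.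
Proof.
  intro E. apply (@operator_unique _ _ (rclosure G) u); [apply rclosure_subspace, G_sub | exact G_closable | |
    exact E].
  apply (epsilon_spec (inhabits zero) (fun g => rclosure G u g)). exists g. exact E.
Qed.

Lemma gramE u v f g : rclosure G u f -> rclosure G v g -> gram u v = ip f g.
Proof. intros Eu Ev. unfold gram. rewrite (closure_valueP Eu), (closure_valueP Ev). reflexivity. Qed.

(** Convergence of u_n in K together with the form is convergence in the graph of the closure of
    [G], which is closed. *)
Lemma gram_closed : closed_nonneg_form (rdom (rclosure G)) gram.
Proof.
  destruct (rclosure_subspace G_sub) as (S0 & Sp & Ss).
  split; [exists zero; exact S0|].
  split; [intros u v [f Ef] [g Eg]; eexists; eauto|].
  split; [intros a u [f Ef]; eexists; eauto|].
  split; [intros u v w [f Ef] [g Eg] [h Eh]|].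
  { rewrite (gramE (Sp _ _ _ _ Ef Eg) Eh), (gramE Ef Eh), (gramE Eg Eh). apply ip_addl. }
  split; [intros a u v [f Ef] [g Eg]|].
  { rewrite (gramE (Ss a _ _ Ef) Eg), (gramE Ef Eg). apply ip_scall. }
  split; [intros u v [f Ef] [g Eg]|].
  { rewrite (gramE Ef Eg), (gramE Eg Ef). apply ip_sym. }
  split; [intros u [f Ef]; rewrite (gramE Ef Ef); apply ip_pos|].
  intros un u Hdom Hu Hcau. set (fn := fun n => closure_value (un n)).
  assert (E : forall n, rclosure G (un n) (fn n)).
  { intro n. destruct (Hdom n) as [f Ef]. unfold fn. rewrite (closure_valueP Ef). exact Ef. }
  assert (M : forall x y f g, rclosure G x f -> rclosure G y g ->
    Re (gram (minus x y) (minus x y)) = hnorm (minus f g) ^ 2).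
  { intros x y f g Ex Ey.
    pose proof (subspace_minus _ _ _ _ (rclosure_subspace G_sub) Ex Ey) as D.
    rewrite (gramE D D). apply ip_self_re. }
  destruct (@complete H fn) as [f Hf].
  { intros eps He. destruct (Hcau (eps ^ 2)) as [N HN]; [nra|]. exists N. intros n m Hn Hm.
    specialize (HN n m Hn Hm). rewrite (M _ _ _ _ (E n) (E m)) in HN.
    pose proof (hnorm_ge0 (minus (fn n) (fn m))). nra. }
  assert (Ef : rclosure G u f).
  { apply rclosure_closed. exists un, fn. auto. }
  split; [exists f; exact Ef|]. intros eps He.
  destruct (Hf (sqrt eps)) as [N HN]; [apply sqrt_lt_R0, He|]. exists N. intros n Hn.
  specialize (HN n Hn). rewrite (M _ _ _ _ (E n) Ef), <- (pow2_sqrt eps) by lra.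
  pose proof (hnorm_ge0 (minus (fn n) f)). nra.
Qed.

End GramForm.

(** * Unitary boundary triples *)

Section UnitaryTriple.
Context {H K : hilbert}.
Variables (Astar : rel H H) (G0 G1 : H -> H -> K).
Hypothesis unitary : gamma_unitary Astar G0 G1.

Lemma Astar_subspace : subspace Astar.
Proof. apply unitary. Qed.

Lemma Astar_plus f f' g g' : Astar f f' -> Astar g g' -> Astar (plus f g) (plus f' g').
Proof. apply Astar_subspace. Qed.

Lemma Astar_scal (a : C) f f' : Astar f f' -> Astar (scal a f) (scal a f').
Proof. apply Astar_subspace. Qed.

Lemma Astar_minus f f' g g' : Astar f f' -> Astar g g' -> Astar (minus f g) (minus f' g').
Proof. intros; apply subspace_minus; auto using Astar_subspace. Qed.

Lemma G_plus f f' g g' : Astar f f' -> Astar g g' ->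
  G0 (plus f g) (plus f' g') = plus (G0 f f') (G0 g g') /\
  G1 (plus f g) (plus f' g') = plus (G1 f f') (G1 g g').
Proof. apply unitary. Qed.

Lemma G_scal (a : C) f f' : Astar f f' ->
  G0 (scal a f) (scal a f') = scal a (G0 f f') /\ G1 (scal a f) (scal a f') = scal a (G1 f f').
Proof. apply unitary. Qed.

Lemma G_zero : G0 zero zero = zero /\ G1 zero zero = zero.
Proof.
  destruct (@G_scal (RtoC 0) zero zero) as [E0 E1]; [apply Astar_subspace|].
  replace (scal (RtoC 0) (@zero H)) with (@zero H) in E0, E1 by vec.
  split; (etransitivity; [eassumption | vec]).
Qed.

Lemma G_minus f f' g g' : Astar f f' -> Astar g g' ->
  G0 (minus f g) (minus f' g') = minus (G0 f f') (G0 g g') /\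
  G1 (minus f g) (minus f' g') = minus (G1 f f') (G1 g g').
Proof.
  intros E E'.
  replace (minus f g) with (plus f (scal (Copp 1) g)) by vec.
  replace (minus f' g') with (plus f' (scal (Copp 1) g')) by vec.
  destruct (G_plus E (Astar_scal (Copp 1) E')) as [-> ->].
  destruct (G_scal (Copp 1) E') as [-> ->]. split; vec.
Qed.

Lemma green_identity f f' g g' : Astar f f' -> Astar g g' ->
  Cminus (ip f' g) (ip f g') = Cminus (ip (G1 f f') (G0 g g')) (ip (G0 f f') (G1 g g')).
Proof. apply unitary. Qed.

Lemma unitary_maximal k k' g g' :
  (forall f f', Astar f f' ->
     Cminus (ip f' g) (ip f g') = Cminus (ip (G1 f f') k) (ip (G0 f f') k')) ->
  Astar g g' /\ G0 g g' = k /\ G1 g g' = k'.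
Proof. apply unitary. Qed.

(** Unitarity characterizes the graph of Gamma by Green's identity against all of A_*, a condition
    that survives limits. *)
Lemma G_closed (f f' : nat -> H) g g' k k' : (forall n, Astar (f n) (f' n)) ->
  conv f g -> conv f' g' ->
  conv (fun n => G0 (f n) (f' n)) k -> conv (fun n => G1 (f n) (f' n)) k' ->
  Astar g g' /\ G0 g g' = k /\ G1 g g' = k'.
Proof.
  intros E Hf Hf' H0 H1. apply unitary_maximal. intros e e' Ee.
  assert (L : ip ((e', opp e) : hprod H H) ((g, g') : hprod H H) =
              ip ((G1 e e', opp (G0 e e')) : hprod K K) ((k, k') : hprod K K)).
  { apply (@conv_ip_eq (hprod H H) (hprod K K) (fun n => (f n, f' n))
      (fun n => (G0 (f n) (f' n), G1 (f n) (f' n)))).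
    - intro n. pose proof (green_identity Ee (E n)) as Q.
      change (Cplus (ip e' (f n)) (ip (opp e) (f' n)) =
        Cplus (ip (G1 e e') (G0 (f n) (f' n))) (ip (opp (G0 e e')) (G1 (f n) (f' n)))).
      rewrite !ip_oppl. exact Q.
    - apply conv_pair; assumption.
    - apply conv_pair; assumption. }
  change (Cplus (ip e' g) (ip (opp e) g') = Cplus (ip (G1 e e') k) (ip (opp (G0 e e')) k')) in L.
  rewrite !ip_oppl in L. exact L.
Qed.

(* Green's identity at the pair itself reads
   Im z |f|^2 + Im mu |G0|^2 = Im (G1 + mu G0, G0) - Im (f' - z f, f). *)
Lemma boundary_lower_bound (z mu : C) : 0 < Im z * Im mu ->
  exists c, 0 < c /\ forall f f', Astar f f' ->
    hnorm ((f, G0 f f') : hprod H K) <=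
    c * hnorm ((minus f' (scal z f), plus (G1 f f') (scal mu (G0 f f'))) : hprod H K).
Proof.
  intro Hs.
  assert (Hz : 0 < Rabs (Im z)) by (apply Rabs_pos_lt; nra).
  assert (Hm : 0 < Rabs (Im mu)) by (apply Rabs_pos_lt; nra).
  set (c := Rmin (Rabs (Im z)) (Rabs (Im mu))).
  assert (Hc : 0 < c) by (apply Rmin_glb_lt; assumption).
  exists (/ c). split; [apply Rinv_0_lt_compat, Hc|]. intros f f' E.
  set (r := minus f' (scal z f)). set (s := plus (G1 f f') (scal mu (G0 f f'))).
  set (a := hnorm ((f, G0 f f') : hprod H K)). set (b := hnorm ((r, s) : hprod H K)).
  assert (Ha : 0 <= a) by apply hnorm_ge0. assert (Hb : 0 <= b) by apply hnorm_ge0.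
  enough (c * a <= b) by (apply (Rmult_le_reg_l c); [exact Hc|];
    rewrite <- Rmult_assoc, Rinv_r; lra).
  destruct (Req_dec a 0) as [Z|NZ]; [rewrite Z; lra|].
  apply (Rmult_le_reg_r a); [lra|].
  assert (Ea : a ^ 2 = hnorm f ^ 2 + hnorm (G0 f f') ^ 2) by apply hnorm_pair_sqr.
  (* Negating f keeps the norm and writes the right side of the identity as the imaginary part of
     one inner product of pairs. *)
  assert (Eo : hnorm ((opp f, G0 f f') : hprod H K) = a).
  { apply hnorm_unique; [exact Ha|]. rewrite ip_self_re, hnorm_pair_sqr, hnorm_opp, Ea. reflexivity. }
  pose proof (ip_cauchy_schwarz ((r, s) : hprod H K) ((opp f, G0 f f') : hprod H K)) as CS.
  rewrite Eo in CS. eapply Rle_trans; [|exact CS].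
  eapply Rle_trans; [|apply im_le_Cmod].
  change (ip ((r, s) : hprod H K) ((opp f, G0 f f') : hprod H K))
    with (Cplus (ip r (opp f)) (ip s (G0 f f'))).
  assert (I : Im (Cplus (ip r (opp f)) (ip s (G0 f f')))
              = Im z * hnorm f ^ 2 + Im mu * hnorm (G0 f f') ^ 2).
  { pose proof (f_equal Im (green_identity E E)) as G. unfold r, s. ip_expand. rewrite !ip_self.
    pose proof (ip_im_sym f f'). pose proof (ip_im_sym (G0 f f') (G1 f f')). cplx. lra. }
  rewrite I. replace (c * a * a) with (c * a ^ 2) by ring. rewrite Ea.
  pose proof (pow2_ge_0 (hnorm f)) as P1. pose proof (pow2_ge_0 (hnorm (G0 f f'))) as P2.
  assert (C1 : c <= Rabs (Im z)) by apply Rmin_l. assert (C2 : c <= Rabs (Im mu)) by apply Rmin_r.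
  assert (Q : Rabs (Im z * hnorm f ^ 2 + Im mu * hnorm (G0 f f') ^ 2) =
    Rabs (Im z) * hnorm f ^ 2 + Rabs (Im mu) * hnorm (G0 f f') ^ 2).
  { destruct (Rlt_le_dec 0 (Im z)).
    - assert (0 < Im mu) by nra.
      rewrite (Rabs_pos_eq (Im z)), (Rabs_pos_eq (Im mu)) by lra. apply Rabs_pos_eq. nra.
    - assert (Im mu <= 0) by nra.
      rewrite (Rabs_left1 (Im z)), (Rabs_left1 (Im mu)) by lra.
      rewrite Rabs_left1; [ring |]. assert (0 <= - Im z * hnorm f ^ 2) by nra. nra. }
  rewrite Q. nra.
Qed.

(** By unitarity, orthogonality says that (x, conj z x) lies in A_* with boundary values -y and conj
    mu y. Green's identity there gives Im z |x|^2 + Im mu |y|^2 = 0. *)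
Lemma boundary_range_orthogonal (z mu : C) (x : H) (y : K) : 0 < Im z * Im mu ->
  (forall f f', Astar f f' ->
    Cplus (ip (minus f' (scal z f)) x) (ip (plus (G1 f f') (scal mu (G0 f f'))) y) = RtoC 0) ->
  x = zero /\ y = zero.
Proof.
  intros Hs Ho.
  destruct (@unitary_maximal (opp y) (scal (Cconj mu) y) x (scal (Cconj z) x)) as (E & E0 & E1).
  { intros f f' E. specialize (Ho f f' E). revert Ho. ip_expand. rewrite !Cconj_conj. intro Ho.
    match type of Ho with ?l = _ =>
      transitivity (Cminus l (Cplus (ip (G1 f f') y) (Cmult mu (ip (G0 f f') y)))) end.
    - ring.
    - rewrite Ho. ring. }
  pose proof (f_equal Im (green_identity E E)) as G. rewrite E0, E1 in G. revert G.
  ip_expand. rewrite !Cconj_conj, !ip_self. intro G.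
  pose proof (hnorm_ge0 x). pose proof (hnorm_ge0 y).
  assert (Z : Im z * (hnorm x) ^ 2 + Im mu * (hnorm y) ^ 2 = 0) by (cplx; lra).
  pose proof (pow2_ge_0 (hnorm x)) as P1. pose proof (pow2_ge_0 (hnorm y)) as P2.
  (* Multiplying by Im z makes both coefficients positive, whichever half-plane z lies in. *)
  assert (Im z ^ 2 * hnorm x ^ 2 + (Im z * Im mu) * hnorm y ^ 2 = 0).
  { transitivity (Im z * (Im z * hnorm x ^ 2 + Im mu * hnorm y ^ 2)); [ring | rewrite Z; ring]. }
  assert (Nz : Im z <> 0) by (intro Nz; rewrite Nz in Hs; lra).
  assert (0 < Im z ^ 2) by (apply pow2_gt_0, Nz).
  assert (0 <= Im z ^ 2 * hnorm x ^ 2) by (apply Rmult_le_pos; lra).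
  assert (0 <= Im z * Im mu * hnorm y ^ 2) by (apply Rmult_le_pos; lra).
  assert (X : Im z ^ 2 * hnorm x ^ 2 = 0) by lra. assert (Y : Im z * Im mu * hnorm y ^ 2 = 0) by lra.
  apply Rmult_integral in X. apply Rmult_integral in Y.
  split; apply hnorm_eq0; [destruct X | destruct Y]; nra.
Qed.

Theorem boundary_problem_solvable (z mu : C) (r : H) (s : K) : 0 < Im z * Im mu ->
  exists f f', Astar f f' /\ f' = plus (scal z f) r /\ plus (G1 f f') (scal mu (G0 f f')) = s.
Proof.
  intro Hs.
  set (P := fun q : hprod H K => exists f f', Astar f f' /\
    q = (minus f' (scal z f), plus (G1 f f') (scal mu (G0 f f')))).
  destruct (@projection (hprod H K) P) with (x := (r, s) : hprod H K) as (p & l & Hp & Hl & Ho).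
  { change (P (@zero H, @zero K)). exists zero, zero. split; [apply Astar_subspace|].
    destruct G_zero as [-> ->]. apply injective_projections; simpl; vec. }
  { intros q q' (f & f' & E & ->) (g & g' & E' & ->). exists (plus f g), (plus f' g').
    split; [apply Astar_plus; assumption|]. destruct (G_plus E E') as [-> ->].
    apply injective_projections; simpl; vec. }
  { intros a q (f & f' & E & ->). exists (scal a f), (scal a f').
    split; [apply Astar_scal; assumption|]. destruct (G_scal a E) as [-> ->].
    apply injective_projections; simpl; vec. }
  assert (Z : minus ((r, s) : hprod H K) l = zero).
  { destruct (@boundary_range_orthogonal z mu (fst (minus ((r, s) : hprod H K) l))
      (snd (minus ((r, s) : hprod H K) l)) Hs) as [Z1 Z2].
    - intros f f' E. apply (Ho (minus f' (scal z f), plus (G1 f f') (scal mu (G0 f f')))).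
      exists f, f'. auto.
    - apply injective_projections; assumption. }
  apply minus_eq0 in Z. subst l. clear Ho.
  set (q := fun n => proj1_sig (constructive_indefinite_description _ (Hp n))).
  assert (Q : forall n, exists f', Astar (q n) f' /\
    p n = (minus f' (scal z (q n)), plus (G1 (q n) f') (scal mu (G0 (q n) f')))).
  { intro n. exact (proj2_sig (constructive_indefinite_description _ (Hp n))). }
  set (q' := fun n => proj1_sig (constructive_indefinite_description _ (Q n))).
  assert (Q' : forall n, Astar (q n) (q' n) /\
    p n = (minus (q' n) (scal z (q n)), plus (G1 (q n) (q' n)) (scal mu (G0 (q n) (q' n))))).
  { intro n. exact (proj2_sig (constructive_indefinite_description _ (Q n))). }
  destruct (boundary_lower_bound z mu Hs) as (c & _ & Hc).
  destruct (@complete (hprod H K) (fun n => (q n, G0 (q n) (q' n)))) as [l Hl'].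
  { apply (@cauchy_dominated _ _ c _ p); [|eapply conv_cauchy, Hl]. intros n m.
    destruct (Q' n) as [En Pn]. destruct (Q' m) as [Em Pm]. rewrite Pn, Pm.
    pose proof (Hc _ _ (Astar_minus En Em)) as B.
    destruct (G_minus En Em) as [E0 E1]. rewrite E0, E1 in B.
    eapply Rle_trans; [exact B|]. right. f_equal. f_equal.
    apply injective_projections; simpl; vec. }
  pose proof (conv_fst Hl') as L0. pose proof (conv_snd Hl') as L1. simpl in L0, L1.
  pose proof (conv_fst Hl) as R0. pose proof (conv_snd Hl) as R1. simpl in R0, R1.
  (* The lower bound controls f and G0 only; the limits of f' and G1 are recovered from the data as
     z f + r and s - mu G0. *)
  destruct (@G_closed q q' (fst l) (plus (scal z (fst l)) r) (snd l) (minus s (scal mu (snd l))))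
    as (E & E0 & E1).
  - apply Q'.
  - exact L0.
  - apply conv_ext with (fun n => plus (scal z (q n)) (fst (p n))).
    + intro n. destruct (Q' n) as [_ ->]. simpl. vec.
    + apply conv_plus; [apply conv_scal, L0 | exact R0].
  - exact L1.
  - apply conv_ext with (fun n => minus (snd (p n)) (scal mu (G0 (q n) (q' n)))).
    + intro n. destruct (Q' n) as [_ ->]. simpl. vec.
    + apply conv_minus; [exact R1 | apply conv_scal, L1].
  - exists (fst l), (plus (scal z (fst l)) r). split; [exact E | split; [reflexivity|]].
    rewrite E0, E1. vec.
Qed.

(** * The gamma-field *)

Let gam := gammaF Astar G0.
Let M := Weyl Astar G0 G1.

Lemma A0_subspace : subspace (A0 Astar G0).
Proof.
  assert (E : Astar zero zero) by apply Astar_subspace.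
  split; [|split].
  - split; [exact E | apply G_zero].
  - intros f f' g g' [Ef Zf] [Eg Zg]. split; [apply Astar_plus; assumption|].
    destruct (G_plus Ef Eg) as [-> _]. rewrite Zf, Zg. vec.
  - intros a f f' [Ef Zf]. split; [apply Astar_scal; assumption|].
    destruct (G_scal a Ef) as [-> _]. rewrite Zf. vec.
Qed.

Lemma A0_symmetric : symmetric (A0 Astar G0).
Proof.
  intros f f' [Ef Zf] g g' [Eg Zg]. pose proof (green_identity Eg Ef) as Q.
  rewrite Zf, Zg, ip_zerol, ip_zeror in Q.
  replace (ip g' f) with (Cplus (Cminus (ip g' f) (ip g f')) (ip g f')) by ring.
  rewrite Q. ring.
Qed.

Lemma gamma_subspace l : subspace (gam l).
Proof.
  assert (E : Astar zero zero) by apply Astar_subspace.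
  split; [|split].
  - unfold gam, gammaF. replace (scal l (@zero H)) with (@zero H) by vec. apply A0_subspace.
  - intros h f k g [Ef <-] [Eg <-]. unfold gam, gammaF.
    replace (scal l (plus f g)) with (plus (scal l f) (scal l g)) by vec.
    split; [apply Astar_plus; assumption | apply (G_plus Ef Eg)].
  - intros a h f [Ef <-]. unfold gam, gammaF.
    replace (scal l (scal a f)) with (scal a (scal l f)) by vec.
    split; [apply Astar_scal, Ef | apply (G_scal a Ef)].
Qed.

(** The G0-term of a drops out of Green's identity. Thus ran (A_0 - conj l) lies in the domain of
    the adjoint of gamma(l), which sends a' - conj l a to G1 a. *)
Lemma gamma_green l a a' h f : A0 Astar G0 a a' -> gam l h f ->
  ip (minus a' (scal (Cconj l) a)) f = ip (G1 a a') h.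
Proof.
  intros [Ea Za] [Ef <-]. pose proof (green_identity Ea Ef) as Q.
  rewrite Za, ip_zerol in Q. revert Q. ip_expand. intro Q.
  rewrite Q. ring.
Qed.

(** If u_n -> 0 and gamma(l) u_n -> y, the limit of the preceding identity makes y orthogonal to the
    dense range. *)
Lemma total_gamma_closable l : total_range (A0 Astar G0) (Cconj l) -> closable (gam l).
Proof.
  intros Ht y (u & f & E & Hu & Hf). apply Ht. intros a a' Ea.
  rewrite <- (ip_zeror (G1 a a')).
  apply (conv_ip_eq (u := f) (v := u)); [|assumption..].
  intro n. apply gamma_green; auto.
Qed.

(* The adjoint of gamma(l) has domain ran (A0 - conj l): a vector (e, -k) of its graph is hit
   by the solution a of a' - conj l a = e, G1 a + conj l G0 a = -k, whose trace G0 a is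
   orthogonal to every G1 f + l G0 f, hence vanishes. *)
Lemma gamma_adjoint_range l k e : Im l <> 0 ->
  (forall h f, gam l h f -> Cplus (ip h k) (ip f e) = RtoC 0) ->
  exists a a', A0 Astar G0 a a' /\ minus a' (scal (Cconj l) a) = e.
Proof.
  intros Hl Ho.
  assert (Hl2 : 0 < Im l * Im l) by nra.
  destruct (boundary_problem_solvable (Cconj l) (Cconj l) e (opp k))
    as (a & a' & Ea & -> & Es); [rewrite im_conj; nra|].
  (* This f has G1 f + l G0 f = G0 a, so the orthogonality tests G0 a against itself. *)
  destruct (boundary_problem_solvable l l zero
    (G0 a (plus (scal (Cconj l) a) e)) Hl2) as (f & f' & Ef & -> & Et).
  assert (Zf : plus (scal l f) zero = scal l f) by vec. rewrite Zf in Ef, Et.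
  set (a' := plus (scal (Cconj l) a) e) in *.
  exists a, a'. split; [|unfold a'; vec]. split; [exact Ea|].
  apply ip_def. rewrite <- Et at 2. ip_expand.
  pose proof (green_identity Ea Ef) as Q.
  assert (O : Cplus (ip k (G0 f (scal l f))) (ip e f) = RtoC 0).
  { rewrite (ip_sym H f e), (ip_sym K (G0 f (scal l f)) k), <- Cplus_conj, Ho.
    - apply C_eq_parts; simpl; ring.
    - split; [exact Ef | reflexivity]. }
  assert (S : Cplus (ip (G1 a a') (G0 f (scal l f))) (Cmult (Cconj l) (ip (G0 a a') (G0 f (scal l f))))
     = Copp (ip k (G0 f (scal l f)))).
  { rewrite <- ip_scall, <- ip_addl, Es. apply ip_oppl. }
  assert (Q' : ip e f = Cminus (ip (G1 a a') (G0 f (scal l f))) (ip (G0 a a') (G1 f (scal l f)))).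
  { rewrite <- Q. unfold a'. ip_expand. ring. }
  transitivity (Cminus (Cplus (ip (G1 a a') (G0 f (scal l f)))
      (Cmult (Cconj l) (ip (G0 a a') (G0 f (scal l f)))))
      (Cminus (ip (G1 a a') (G0 f (scal l f))) (ip (G0 a a') (G1 f (scal l f))))); [ring|].
  rewrite S, <- Q'. transitivity (Copp (Cplus (ip k (G0 f (scal l f))) (ip e f))); [ring|].
  rewrite O. ring.
Qed.

(** For g orthogonal to ran (A_0 - conj l), project (0, g) onto the graph of gamma(l). The remainder
    is orthogonal to the graph, so its second entry lies in that range and the remainder is
    orthogonal to (0, g) too. It vanishes, (0, g) is in the closure, and g = 0. *)
Lemma gamma_closable_total l : Im l <> 0 -> closable (gam l) ->
  total_range (A0 Astar G0) (Cconj l).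
Proof.
  intros Hl Hc g Hg. destruct (gamma_subspace l) as (S0 & Sp & Ss).
  set (x := (zero, g) : hprod K H).
  destruct (@projection (hprod K H) (fun q => gam l (fst q) (snd q))) with (x := x)
    as (p & m & Hp & Hm & Ho); [exact S0 | intros; apply Sp; assumption | intros; apply Ss; assumption |].
  set (y := minus x m) in *.
  destruct (@gamma_adjoint_range l (fst y) (snd y) Hl) as (a & a' & Ea & Ee).
  { intros h f E. exact (Ho (h, f) E). }
  assert (Z : y = zero).
  { apply ip_def. unfold y at 2. rewrite ip_minusr.
    assert (Y1 : ip y m = RtoC 0).
    { apply (@conv_ip_eq0 _ p); [|exact Hm]. intro n. rewrite ip_sym, Ho by apply Hp.
      apply C_eq_parts; simpl; ring. }
    assert (Y2 : ip y x = RtoC 0).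
    { change (Cplus (ip (fst y) zero) (ip (snd y) g) = RtoC 0).
      rewrite ip_zeror, <- Ee, Hg by exact Ea. ring. }
    rewrite Y1, Y2. ring. }
  apply minus_eq0 in Z. subst m. apply Hc.
  exists (fun n => fst (p n)), (fun n => snd (p n)).
  split; [exact Hp | split; [exact (conv_fst Hm) | exact (conv_snd Hm)]].
Qed.

Lemma ess_selfadjoint_gamma_closable l :
  ess_selfadjoint (A0 Astar G0) -> Im l <> 0 -> closable (gam l).
Proof.
  intros He Hl. apply total_gamma_closable, ess_selfadjoint_total; [exact He|].
  rewrite im_conj. lra.
Qed.

Lemma gamma_closable_ess_selfadjoint :
  closable (gam Ci) -> closable (gam mCi) -> ess_selfadjoint (A0 Astar G0).
Proof.
  intros Hi Hmi. apply total_ess_selfadjoint; [apply A0_subspace | apply A0_symmetric | |].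
  (* The half-planes are exchanged: gamma(-i) governs the range of A_0 - i. *)
  - rewrite <- (Cconj_conj Ci). apply (@gamma_closable_total mCi); [simpl; lra | exact Hmi].
  - apply (@gamma_closable_total Ci); [simpl; lra | exact Hi].
Qed.

Lemma dom_gamma_closure_sub l h : rdom (rclosure (gam l)) h -> ran_closure_G0 Astar G0 h.
Proof.
  intros (g & u & f & E & Hu & Hf). exists f, (fun n => scal l (f n)), g, (scal l g).
  split; [intro n; apply E|]. split; [exact Hf|]. split; [apply conv_scal, Hf|].
  apply conv_ext with u; [|exact Hu]. intro n. symmetry. apply E.
Qed.

(* Given f_n in A_*, subtract a_n in A0 with a_n' - l a_n close to f_n' - l f_n, and repair the
   remaining defect exactly with a small solution d_n of the boundary problem. *)
Lemma ran_closure_G0_sub l h : ess_selfadjoint (A0 Astar G0) -> Im l <> 0 ->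
  ran_closure_G0 Astar G0 h -> rdom (rclosure (gam l)) h.
Proof.
  intros He Hl (f & f' & g & g' & Ef & Hf & Hf' & H0).
  assert (Hl2 : 0 < Im l * Im l) by nra.
  destruct (boundary_lower_bound l l Hl2) as (c & Hc0 & Hc).
  set (r := (fun n => minus (f' n) (scal l (f n))) : nat -> H).
  assert (Hr : conv r (minus g' (scal l g))) by (apply conv_minus; [|apply conv_scal]; assumption).
  assert (Hn : forall n, exists q : H * H * (H * H), let a := fst (fst q) in let a' := snd (fst q) in
    let d := fst (snd q) in let d' := snd (snd q) in
    A0 Astar G0 a a' /\ Astar d d' /\
    d' = plus (scal l d) (minus (r n) (minus a' (scal l a))) /\
    hnorm (minus (minus a' (scal l a)) (r n)) <= / (INR n + 1) /\
    hnorm d <= c * / (INR n + 1) /\ hnorm (G0 d d') <= c * / (INR n + 1)).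
  { intro n.
    destruct (@total_range_dense _ (A0 Astar G0) l (r n) A0_subspace
      (ess_selfadjoint_total l He Hl)) as (a & a' & Ea & Ha).
    destruct (Ha _ (inv_INR_pos n)) as [N HN]. specialize (HN N (Nat.le_refl N)).
    destruct (boundary_problem_solvable l l
      (minus (r n) (minus (a' N) (scal l (a N)))) zero Hl2) as (d & d' & Ed & Ed' & Es).
    assert (B : hnorm ((d, G0 d d') : hprod H K) <= c * / (INR n + 1)).
    { eapply Rle_trans; [apply (Hc _ _ Ed)|]. apply Rmult_le_compat_l; [lra|].
      rewrite Es. eapply Rle_trans; [apply hnorm_pair_le|].
      rewrite hnorm_zero. rewrite Ed'.
      replace (minus (plus (scal l d) (minus (r n) (minus (a' N) (scal l (a N))))) (scal l d))
        with (minus (r n) (minus (a' N) (scal l (a N)))) by vec.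
      rewrite hnorm_minus_sym. lra. }
    exists ((a N, a' N), (d, d')). cbn [fst snd]. repeat (split; [first [apply Ea | assumption | lra]|]).
    split; [|eapply Rle_trans; [|exact B]; apply hnorm_snd_pair].
    eapply Rle_trans; [|exact B]. apply hnorm_fst_pair. }
  set (q := fun n => proj1_sig (constructive_indefinite_description _ (Hn n))).
  set (a := fun n => fst (fst (q n))). set (a' := fun n => snd (fst (q n))).
  set (d := fun n => fst (snd (q n))). set (d' := fun n => snd (snd (q n))).
  assert (Q : forall n, A0 Astar G0 (a n) (a' n) /\ Astar (d n) (d' n) /\
    d' n = plus (scal l (d n)) (minus (r n) (minus (a' n) (scal l (a n)))) /\
    hnorm (minus (minus (a' n) (scal l (a n))) (r n)) <= / (INR n + 1) /\
    hnorm (d n) <= c * / (INR n + 1) /\ hnorm (G0 (d n) (d' n)) <= c * / (INR n + 1)).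
  { intro n. exact (proj2_sig (constructive_indefinite_description _ (Hn n))). }
  assert (Hw : conv (fun n => minus (a' n) (scal l (a n))) (minus g' (scal l g))).
  { apply conv_ext with (fun n => plus (r n) (minus (minus (a' n) (scal l (a n))) (r n))).
    - intro n. vec.
    - replace (minus g' (scal l g)) with (plus (minus g' (scal l g) : H) (@zero H)) by vec.
      apply conv_plus; [exact Hr|]. apply (@conv_zero_of_rate _ 1).
      intro n. rewrite Rmult_1_l. apply Q. }
  (* A_0 is symmetric and l nonreal, so a_n inherits convergence from a_n' - l a_n. *)
  destruct (@complete H a) as [b Hb].
  { apply (@cauchy_dominated _ _ (/ Rabs (Im l)) a (fun n => minus (a' n) (scal l (a n))));
      [|eapply conv_cauchy, Hw].
    intros n m. destruct (Q n) as [En _]. destruct (Q m) as [Em _].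
    pose proof (symmetric_lower_bound l _ _ A0_symmetric
      (subspace_minus _ _ _ _ A0_subspace En Em)) as B.
    assert (0 < Rabs (Im l)) by (apply Rabs_pos_lt, Hl).
    apply (Rmult_le_reg_l (Rabs (Im l))); [assumption|].
    rewrite <- Rmult_assoc, Rinv_r, Rmult_1_l by lra.
    replace (minus (minus (a' n) (scal l (a n))) (minus (a' m) (scal l (a m))))
      with (minus (minus (a' n) (a' m)) (scal l (minus (a n) (a m)))) by vec.
    exact B. }
  assert (Hd : conv d zero) by (apply (@conv_zero_of_rate _ c); intro n; apply Q).
  assert (Hd0 : conv (fun n => G0 (d n) (d' n)) zero)
    by (apply (@conv_zero_of_rate _ c); intro n; apply Q).
  exists (minus (minus g b) (@zero H)), (fun n => minus (minus (G0 (f n) (f' n)) (@zero K)) (G0 (d n) (d' n))),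
    (fun n => minus (minus (f n) (a n)) (d n)).
  split; [|split].
  - intro n. destruct (Q n) as ([Ea Za] & Ed & Ed' & _).
    pose proof (Astar_minus (Ef n) Ea) as E1.
    pose proof (Astar_minus E1 Ed) as E2.
    assert (V : minus (minus (f' n) (a' n)) (d' n) = scal l (minus (minus (f n) (a n)) (d n))).
    { rewrite Ed'. unfold r. vec. }
    unfold gam, gammaF. rewrite <- V. split; [exact E2|].
    destruct (G_minus E1 Ed) as [-> _]. destruct (G_minus (Ef n) Ea) as [-> _].
    rewrite Za. reflexivity.
  - replace h with (minus (minus h (@zero K)) (@zero K)) at 1 by vec.
    apply conv_minus; [apply conv_minus; [exact H0 | apply conv_const] | exact Hd0].
  - apply conv_minus; [apply conv_minus; assumption | exact Hd].
Qed.

(** For f' = l f and g' = l g the left side of Green's identity is (l - conj l) (f, g). *)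
Lemma weyl_form l u v c : Im l <> 0 ->
  tform (M l) l u v c <-> exists f g, gam l u f /\ gam l v g /\ c = ip f g.
Proof.
  intro Hl.
  assert (Nl : Cminus l (Cconj l) <> RtoC 0).
  { intro E. apply (f_equal Im) in E. cplx. lra. }
  assert (F : forall f g, Astar f (scal l f) -> Astar g (scal l g) ->
    Cdiv (Cminus (ip (G1 f (scal l f)) (G0 g (scal l g))) (ip (G0 f (scal l f)) (G1 g (scal l g))))
      (Cminus l (Cconj l)) = ip f g).
  { intros f g Ef Eg. rewrite <- (green_identity Ef Eg). ip_expand. field. exact Nl. }
  split.
  - intros (Mu & Mv & (f & Ef & <- & <-) & (g & Eg & <- & <-) & ->).
    exists f, g. split; [split; auto | split; [split; auto|]]. apply F; assumption.
  - intros (f & g & [Ef <-] & [Eg <-] & ->).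
    exists (G1 f (scal l f)), (G1 g (scal l g)).
    split; [exists f; auto | split; [exists g; auto|]]. symmetry. apply F; assumption.
Qed.

Lemma form_extends_gamma l D s : Im l <> 0 ->
  form_extends (M l) l D s <->
  (forall u f, gam l u f -> D u) /\
  (forall u v f g, gam l u f -> gam l v g -> s u v = ip f g).
Proof.
  intro Hl. split; intros [E1 E2]; split.
  - intros u f [Ef <-]. apply E1. exists (G1 f (scal l f)), f. auto.
  - intros u v f g Ef Eg. apply E2, weyl_form; [exact Hl|]. exists f, g. auto.
  - intros u (v & f & Ef & <- & _). apply (E1 _ f). split; auto.
  - intros u v c Ec. apply weyl_form in Ec; [|exact Hl]. destruct Ec as (f & g & Ef & Eg & ->).
    apply E2; assumption.
Qed.

Lemma gram_extends_weyl l : Im l <> 0 -> closable (gam l) ->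
  form_extends (M l) l (rdom (rclosure (gam l))) (gram (gam l)).
Proof.
  intros Hl Hc. apply form_extends_gamma; [exact Hl|]. split.
  - intros u f E. exists f. apply rclosure_incl, E.
  - intros u v f g Eu Ev. apply gramE; [apply gamma_subspace | exact Hc | |];
      apply rclosure_incl; assumption.
Qed.

Lemma form_closable_gamma l : Im l <> 0 -> form_closable (M l) l <-> closable (gam l).
Proof.
  intro Hl. split.
  - intros (D & s & Hcl & Hext) g Hg. apply form_extends_gamma in Hext; [|exact Hl].
    destruct Hext as [HD Hs].
    apply (closed_form_dom_closure (gamma_subspace l) Hcl HD Hs Hg). reflexivity.
  - intro Hc. exists (rdom (rclosure (gam l))), (gram (gam l)). split.
    + apply gram_closed; [apply gamma_subspace | exact Hc].
    + apply gram_extends_weyl; assumption.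
Qed.

(** [gram (gam l)] is itself a closed extension, and its domain is contained in that of every other
    one. *)
Lemma dom_form_closure_gamma l h : Im l <> 0 -> closable (gam l) ->
  dom_form_closure (M l) l h <-> rdom (rclosure (gam l)) h.
Proof.
  intros Hl Hc. split.
  - intro Hd. apply (Hd _ (gram (gam l))).
    + apply gram_closed; [apply gamma_subspace | exact Hc].
    + apply gram_extends_weyl; assumption.
  - intros [g Hg] D s Hcl Hext. apply form_extends_gamma in Hext; [|exact Hl].
    destruct Hext as [HD Hs]. apply (closed_form_dom_closure (gamma_subspace l) Hcl HD Hs Hg).
Qed.

(** * The Weyl function *)

Lemma weyl_im l u v : M l u v -> exists f, gam l u f /\ Im (ip v u) = Im l * hnorm f ^ 2.
Proof.
  intros (f & Ef & <- & <-). exists f. split; [split; auto|].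
  pose proof (f_equal Im (green_identity Ef Ef)) as Q. revert Q. ip_expand. rewrite ip_self. intro Q.
  pose proof (ip_im_sym (G0 f (scal l f)) (G1 f (scal l f))). cplx. lra.
Qed.

Lemma gamma_zero l f : Im l <> 0 -> gam l zero f -> f = zero.
Proof.
  intros Hl [Ef Z]. apply (@eigenvector_symmetric _ l); [exact Hl|].
  apply A0_symmetric; split; assumption.
Qed.

Lemma weyl_subspace l : subspace (M l).
Proof.
  destruct (gamma_subspace l) as (S0 & Sp & Ss). split; [|split].
  - destruct S0 as [E Z]. exists zero. split; [exact E | split; [exact Z|]].
    replace (scal l (@zero H)) with (@zero H) by vec. apply G_zero.
  - intros h k h' k' (f & Ef & E0 & <-) (g & Eg & E0' & <-). exists (plus f g).
    destruct (Sp h f h' g (conj Ef E0) (conj Eg E0')) as [E Z].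
    split; [exact E | split; [exact Z|]].
    replace (scal l (plus f g)) with (plus (scal l f) (scal l g)) by vec.
    apply (G_plus Ef Eg).
  - intros a h k (f & Ef & E0 & <-). exists (scal a f).
    destruct (Ss a h f (conj Ef E0)) as [E Z].
    split; [exact E | split; [exact Z|]].
    replace (scal l (scal a f)) with (scal a (scal l f)) by vec.
    apply (G_scal a Ef).
Qed.

Lemma weyl_operator l : Im l <> 0 -> is_operator (M l).
Proof.
  intros Hl k (f & Ef & E0 & <-).
  assert (Z : f = zero) by (apply (@gamma_zero l); [exact Hl | split; assumption]).
  subst f. replace (scal l (@zero H)) with (@zero H) by vec. apply G_zero.
Qed.

Lemma weyl_resolvent l mu s : 0 < Im l * Im mu ->
  exists f, Astar f (scal l f) /\ plus (G1 f (scal l f)) (scal mu (G0 f (scal l f))) = s.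
Proof.
  intro Hs. destruct (boundary_problem_solvable l mu zero s Hs) as (f & f' & E & -> & Es).
  assert (Z : plus (scal l f) zero = scal l f) by vec. rewrite Z in E, Es. eauto.
Qed.

(** The boundary estimate with z = mu = l bounds the eigenvectors by v_n + l u_n, so they converge
    and closedness of Gamma applies. *)
Lemma weyl_closed l : Im l <> 0 -> rclosed (M l).
Proof.
  intros Hl u v (un & vn & E & Hu & Hv).
  assert (Hl2 : 0 < Im l * Im l) by nra.
  destruct (boundary_lower_bound l l Hl2) as (c & Hc0 & Hc).
  set (f := fun n => proj1_sig (constructive_indefinite_description _ (E n))).
  assert (F : forall n, Astar (f n) (scal l (f n)) /\ G0 (f n) (scal l (f n)) = un n /\
    G1 (f n) (scal l (f n)) = vn n).
  { intro n. exact (proj2_sig (constructive_indefinite_description _ (E n))). }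
  destruct (@complete H f) as [g Hg].
  { apply (@cauchy_dominated _ _ c f (fun n => plus (vn n) (scal l (un n)))).
    - intros n m. destruct (F n) as (En & <- & <-). destruct (F m) as (Em & <- & <-).
      pose proof (Hc _ _ (Astar_minus En Em)) as B. destruct (G_minus En Em) as [Z0 Z1].
      rewrite Z0, Z1 in B. eapply Rle_trans; [eapply hnorm_fst_pair|].
      eapply Rle_trans; [exact B|]. apply Rmult_le_compat_l; [lra|].
      eapply Rle_trans; [apply hnorm_pair_le|].
      replace (minus (minus (scal l (f n)) (scal l (f m))) (scal l (minus (f n) (f m))))
        with (@zero H) by vec.
      rewrite hnorm_zero, Rplus_0_l. right. f_equal. vec.
    - eapply conv_cauchy, conv_plus; [exact Hv | apply conv_scal, Hu]. }
  destruct (@G_closed f (fun n => scal l (f n)) g (scal l g) u v) as (Eg & E0 & E1).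
  - apply F.
  - exact Hg.
  - apply conv_scal, Hg.
  - apply conv_ext with un; [|exact Hu]. intro n. symmetry. apply F.
  - apply conv_ext with vn; [|exact Hv]. intro n. symmetry. apply F.
  - exists g. auto.
Qed.

(** M(l) + l is onto. For (u, v) in a dissipative extension, some (h, k) in M(l) has k + l h = v + l
    u; the difference (u - h, -l (u - h)) is dissipative only if u = h. *)
Lemma weyl_max_dissipative l : 0 < Im l -> max_dissipative (M l).
Proof.
  intro Hl. split; [apply weyl_subspace|]. split.
  - intros u v E. destruct (weyl_im E) as (f & _ & ->).
    apply Rmult_le_pos; [lra | apply pow2_ge_0].
  - intros S HS Hd Hsub u v E.
    destruct (@weyl_resolvent l l (plus v (scal l u))) as (f & Ef & Es); [nra|].
    set (h := G0 f (scal l f)) in *. set (k := G1 f (scal l f)) in *.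
    assert (Em : M l h k) by (exists f; auto).
    pose proof (subspace_minus _ _ _ _ HS E (Hsub _ _ Em)) as D.
    assert (V : minus v k = scal (Copp l) (minus u h)).
    { apply vec_ext; intro x. pose proof (f_equal (fun y => ip y x) Es) as Q. simpl in Q.
      revert Q. ip_expand. intro Q.
      transitivity (Cminus (Cminus (Cplus (ip v x) (Cmult l (ip u x))) (ip k x)) (Cmult l (ip u x)));
        [ring|]. rewrite <- Q. ring. }
    rewrite V in D. apply Hd in D. rewrite ip_scall, ip_self in D.
    assert (Z : u = h).
    { apply minus_eq0, hnorm_eq0. pose proof (hnorm_ge0 (minus u h)).
      assert (P : Im l * hnorm (minus u h) ^ 2 <= 0) by (cplx; lra).
      apply NNPP. intro N. assert (0 < Im l * hnorm (minus u h) ^ 2); [|lra].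
      apply Rmult_lt_0_compat; [exact Hl | apply pow2_gt_0, N]. }
    assert (Z' : v = k).
    { apply minus_eq0. rewrite V, Z. vec. }
    rewrite Z, Z'. exact Em.
Qed.

(** One inclusion is Green's identity. For the other, surjectivity of M(conj l) + conj l gives (h,
    k) in M(conj l) with k + conj l h = v + conj l u, and u - h is orthogonal to ran (M(l) + l), the
    whole space. *)
Lemma weyl_adjoint l u v : Im l <> 0 -> radjoint (M l) u v <-> M (Cconj l) u v.
Proof.
  intro Hl.
  assert (S : forall x y x' y', M l x y -> M (Cconj l) x' y' -> ip y x' = ip x y').
  { intros x y x' y' (f & Ef & <- & <-) (e & Ee & <- & <-).
    pose proof (green_identity Ef Ee) as Q. revert Q. ip_expand. rewrite Cconj_conj. intro Q.
    match type of Q with _ = Cminus ?p ?q => transitivity (Cplus (Cminus p q) q) end; [ring|].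
    rewrite <- Q. ring. }
  split; [|intros E x y Ex; exact (S _ _ _ _ Ex E)]. intro Ha.
  destruct (@weyl_resolvent (Cconj l) (Cconj l) (plus v (scal (Cconj l) u))) as (e & Ee & Es);
    [rewrite im_conj; nra|].
  set (h := G0 e (scal (Cconj l) e)) in *. set (k := G1 e (scal (Cconj l) e)) in *.
  assert (Em : M (Cconj l) h k) by (exists e; auto).
  destruct (@weyl_resolvent l l (minus u h)) as (f & Ef & Et); [nra|].
  set (x := G0 f (scal l f)) in *. set (y := G1 f (scal l f)) in *.
  assert (Ex : M l x y) by (exists f; auto).
  assert (V : plus v (scal (Cconj l) u) = plus k (scal (Cconj l) h)) by auto.
  assert (Z : u = h).
  { apply minus_eq0, ip_def. rewrite <- Et at 1.
    pose proof (Ha _ _ Ex) as A1. pose proof (S _ _ _ _ Ex Em) as A2.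
    pose proof (f_equal (fun q => ip x q) V) as Q. simpl in Q. revert Q.
    ip_expand. rewrite !Cconj_conj, A1, A2. intro Q.
    transitivity (Cminus (Cplus (ip x v) (Cmult l (ip x u))) (Cplus (ip x k) (Cmult l (ip x h))));
      [ring|]. rewrite Q. ring. }
  assert (Z' : v = k).
  { rewrite Z in V. exact (plus_reg_r _ _ _ V). }
  rewrite Z, Z'. exact Em.
Qed.

(** Green's identity for (f, z f) and (e, conj w e), whose left side is (z - w) (f, e); the terms
    with mu cancel. *)
Lemma weyl_resolvent_identity (z w mu : C) f e h k :
  Astar f (scal z f) -> plus (G1 f (scal z f)) (scal mu (G0 f (scal z f))) = h ->
  Astar e (scal (Cconj w) e) ->
  plus (G1 e (scal (Cconj w) e)) (scal (Cconj mu) (G0 e (scal (Cconj w) e))) = k ->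
  ip (G0 f (scal z f)) k =
    Cminus (ip h (G0 e (scal (Cconj w) e))) (Cmult (Cminus z w) (ip f e)).
Proof.
  intros Ef <- Ee <-. pose proof (green_identity Ef Ee) as Q. revert Q. ip_expand.
  rewrite !Cconj_conj. intro Q.
  replace (Cmult (Cminus z w) (ip f e)) with (Cminus (Cmult z (ip f e)) (Cmult w (ip f e))) by ring.
  rewrite Q. ring.
Qed.

(** f - g solves the problem at w with right side (z - w) f and zero boundary data, so |f - g| <= c
    |z - w| (|f - g| + |g|); the smallness of z - w absorbs the first term. *)
Lemma weyl_solution_continuous (w mu : C) : 0 < Im w * Im mu ->
  exists c, 0 < c /\ forall z f g h, Cmod (Cminus z w) * c <= / 2 ->
    Astar f (scal z f) -> plus (G1 f (scal z f)) (scal mu (G0 f (scal z f))) = h ->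
    Astar g (scal w g) -> plus (G1 g (scal w g)) (scal mu (G0 g (scal w g))) = h ->
    hnorm (minus f g) <= 2 * c * Cmod (Cminus z w) * hnorm g.
Proof.
  intro Hs. destruct (boundary_lower_bound w mu Hs) as (c & Hc0 & Hc).
  exists c. split; [exact Hc0|]. intros z f g h Hz Ef Hf Eg Hg.
  pose proof (Hc _ _ (Astar_minus Ef Eg)) as B. destruct (G_minus Ef Eg) as [Z0 Z1].
  rewrite Z0, Z1 in B. set (t := Cmod (Cminus z w)) in *.
  assert (B1 : hnorm (minus f g) <= c * (t * hnorm f)).
  { eapply Rle_trans; [eapply hnorm_fst_pair|].
    eapply Rle_trans; [exact B|]. apply Rmult_le_compat_l; [lra|].
    eapply Rle_trans; [apply hnorm_pair_le|].
    replace (minus (minus (scal z f) (scal w g)) (scal w (minus f g)))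
      with (scal (Cminus z w) f) by vec.
    replace (plus (minus (G1 f (scal z f)) (G1 g (scal w g)) : K)
      (scal mu (minus (G0 f (scal z f)) (G0 g (scal w g))))) with (@zero K).
    - rewrite hnorm_zero, hnorm_scal. fold t. lra.
    - transitivity (minus h h); [vec|]. rewrite <- Hf at 1. rewrite <- Hg. vec. }
  assert (B2 : hnorm f <= hnorm (minus f g) + hnorm g).
  { replace f with (plus (minus f g) g) at 1 by vec. apply hnorm_plus. }
  pose proof (hnorm_ge0 f). pose proof (hnorm_ge0 g). pose proof (hnorm_ge0 (minus f g)).
  assert (0 <= t) by apply Cmod_ge_0. assert (0 <= t * c) by nra.
  assert (c * (t * hnorm f) <= t * c * hnorm (minus f g) + t * c * hnorm g) by nra.
  assert (t * c * hnorm (minus f g) <= / 2 * hnorm (minus f g)) by nra. nra.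
Qed.

Lemma weyl_resolvent_holomorphic (mu : C) (h k : K) : 0 < Im mu -> exists phi : C -> C,
  forall z, 0 < Im z ->
    @ex_derive C_AbsRing C_NormedModule phi z /\
    (exists g, M z g (minus h (scal mu g))) /\
    (forall g, M z g (minus h (scal mu g)) -> phi z = ip g k).
Proof.
  intro Hmu.
  set (sol := fun z f => Astar f (scal z f) /\
    plus (G1 f (scal z f)) (scal mu (G0 f (scal z f))) = h).
  set (F := fun z => epsilon (inhabits zero) (sol z)).
  assert (HF : forall z, 0 < Im z -> sol z (F z)).
  { intros z Hz. apply epsilon_spec. apply weyl_resolvent. nra. }
  assert (dual : forall w, 0 < Im w -> exists e, Astar e (scal (Cconj w) e) /\
    plus (G1 e (scal (Cconj w) e)) (scal (Cconj mu) (G0 e (scal (Cconj w) e))) = k).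
  { intros w Hw. apply weyl_resolvent. rewrite !im_conj. nra. }
  set (phi := fun z => ip (G0 (F z) (scal z (F z))) k).
  exists phi. intros w Hw. destruct (dual w Hw) as (e & Ee & Ek).
  destruct (HF w Hw) as [Ew Hh]. split; [|split].
  (* By the resolvent identity the linearization error at z is -(z - w) (F z - F w, e), of second
     order in z - w. *)
  - exists (Copp (ip (F w) e)). split; [apply is_linear_scal_l|].
    intros w' Hw' eps.
    apply (@is_filter_lim_locally_unique C_AbsRing (AbsRing_NormedModule C_AbsRing)) in Hw'.
    subst w'.
    destruct (@weyl_solution_continuous w mu) as (c & Hc0 & Hc); [nra|].
    pose proof (hnorm_ge0 (F w)) as P1. pose proof (hnorm_ge0 e) as P2.
    set (A := 2 * c * hnorm (F w) * hnorm e).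
    assert (HA : 0 <= A) by (unfold A; repeat apply Rmult_le_pos; lra).
    pose proof (cond_pos eps) as Heps.
    (* The three radii keep z in the upper half-plane, allow the continuity estimate, and bring A |z
       - w| below eps. *)
    assert (Hd : 0 < Rmin (Im w) (Rmin (/ (2 * c)) (eps / (A + 1)))).
    { repeat apply Rmin_glb_lt; [exact Hw | apply Rinv_0_lt_compat; lra |
        apply Rdiv_lt_0_compat; lra]. }
    exists (mkposreal _ Hd). intros z Hz.
    change (Cmod (Cminus z w) < Rmin (Im w) (Rmin (/ (2 * c)) (eps / (A + 1)))) in Hz.
    change (Cmod (Cminus (Cminus (phi z) (phi w)) (Cmult (Cminus z w) (Copp (ip (F w) e))))
      <= eps * Cmod (Cminus z w)).
    set (t := Cmod (Cminus z w)) in *. assert (Ht : 0 <= t) by apply Cmod_ge_0.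
    assert (T1 : t < Im w) by (eapply Rlt_le_trans; [exact Hz | apply Rmin_l]).
    assert (T2 : t < / (2 * c)).
    { eapply Rlt_le_trans; [exact Hz|]. eapply Rle_trans; [apply Rmin_r | apply Rmin_l]. }
    assert (T3 : t < eps / (A + 1)).
    { eapply Rlt_le_trans; [exact Hz|]. eapply Rle_trans; [apply Rmin_r | apply Rmin_r]. }
    assert (Hz0 : 0 < Im z).
    { pose proof (im_le_Cmod (Cminus z w)) as I. fold t in I.
      pose proof (Rle_abs (- Im (Cminus z w))) as J. rewrite Rabs_Ropp in J. cplx. lra. }
    destruct (HF z Hz0) as [Ez Hhz].
    unfold phi. rewrite (weyl_resolvent_identity z w mu Ez Hhz Ee Ek),
      (weyl_resolvent_identity w w mu Ew Hh Ee Ek).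
    match goal with |- Cmod ?x <= _ =>
      replace x with (Cmult (Copp (Cminus z w)) (ip (minus (F z) (F w)) e)) by (ip_expand; ring) end.
    rewrite Cmod_mult, Cmod_opp. fold t.
    assert (L : hnorm (minus (F z) (F w)) <= 2 * c * t * hnorm (F w)).
    { apply (Hc z (F z) (F w) h); try assumption. fold t.
      apply Rlt_le in T2. apply (Rmult_le_compat_r c) in T2; [|lra].
      replace (/ (2 * c) * c) with (/ 2) in T2 by (field; lra). exact T2. }
    pose proof (ip_cauchy_schwarz (minus (F z) (F w)) e) as CS.
    assert (L2 : Cmod (ip (minus (F z) (F w)) e) <= A * t).
    { eapply Rle_trans; [exact CS|]. unfold A.
      replace (2 * c * hnorm (F w) * hnorm e * t) with (2 * c * t * hnorm (F w) * hnorm e) by ring.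
      apply Rmult_le_compat_r; assumption. }
    apply Rlt_div_r in T3; [|lra]. rewrite (Rmult_comm eps t).
    apply Rmult_le_compat_l; [exact Ht|]. nra.
  - exists (G0 (F w) (scal w (F w))), (F w). split; [exact Ew | split; [reflexivity|]].
    rewrite <- Hh. vec.
  (* At z = w the resolvent identity gives (h, G0 e) for every solution, so the choice made by
     [epsilon] does not matter. *)
  - intros g (f & Ef & E0 & E1). unfold phi.
    rewrite (weyl_resolvent_identity w w mu Ew Hh Ee Ek), <- E0.
    rewrite (@weyl_resolvent_identity w w mu f e h k Ef); [ring | | exact Ee | exact Ek].
    rewrite E1, E0. vec.
Qed.

Lemma weyl_nevanlinna : nevanlinna_Rs M.
Proof.
  split; [split; [|split; [|split]]|].
  - intros l Hl. split; [apply weyl_subspace | split; [apply weyl_closed, Hl | apply weyl_operator, Hl]].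
  - apply weyl_max_dissipative.
  - intros l Hl u v. apply weyl_adjoint, Hl.
  - exists Ci. split; [simpl; lra|]. intros h k. apply weyl_resolvent_holomorphic. simpl. lra.
  (* Im (M(i) h, h) = |gamma(i) h|^2, and a vanishing eigenvector has vanishing boundary value. *)
  - intros h k E Z. destruct (weyl_im E) as (f & [Ef E0] & I). rewrite I in Z. simpl in Z.
    assert (Zf : f = zero) by (apply hnorm_eq0; nra). subst f.
    rewrite <- E0. replace (scal Ci (@zero H)) with (@zero H) by vec. apply G_zero.
Qed.

End UnitaryTriple.

(** * The equivalences and the domains of the closures *)

Unset Implicit Arguments.

Theorem mainTheorem1 (H K : hilbert) (A Astar : rel H H) (G0 G1 : H -> H -> K)
  (hA : subspace A /\ rclosed A /\ symmetric A)
  (hPi : unitary_boundary_triple A Astar G0 G1) :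
  let M := Weyl Astar G0 G1 in
  let gam := gammaF Astar G0 in
  let i_ := ess_selfadjoint (A0 Astar G0) in
  let ii_ := closable (gam Ci) /\ closable (gam mCi) in
  let iii_ := (forall l, Im l <> 0 -> closable (gam l)) /\
              (forall l, Cp l -> forall h, rdom (rclosure (gam l)) h <-> rdom (rclosure (gam Ci)) h) /\
              (forall l, Cm l -> forall h, rdom (rclosure (gam l)) h <-> rdom (rclosure (gam mCi)) h) in
  let iv_ := form_closable (M Ci) Ci /\ form_closable (M mCi) mCi in
  let v_ := (forall l, Im l <> 0 -> form_closable (M l) l) /\
            (forall l, Cp l -> forall h, dom_form_closure (M l) l h <-> dom_form_closure (M Ci) Ci h) /\
            (forall l, Cm l -> forall h, dom_form_closure (M l) l h <-> dom_form_closure (M mCi) mCi h) in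
  let vi_ := nevanlinna_Rs M /\ form_domain_invariant M Cp /\ form_domain_invariant M Cm in
  (i_ <-> ii_) /\ (i_ <-> iii_) /\ (i_ <-> iv_) /\ (i_ <-> v_) /\ (i_ <-> vi_) /\
  (i_ -> forall l, Im l <> 0 -> forall h,
      (dom_form_closure (M l) l h <-> rdom (rclosure (gam l)) h) /\
      (rdom (rclosure (gam l)) h <-> ran_closure_G0 Astar G0 h)).
Proof.
  intros M gam i_ ii_ iii_ iv_ v_ vi_.
  destruct hPi as [HU _].
  assert (Ni : Im Ci <> 0) by (simpl; lra).
  assert (Nmi : Im mCi <> 0) by (simpl; lra).
  assert (Np : forall l, Cp l -> Im l <> 0) by (unfold Cp; intros; lra).
  assert (Nm : forall l, Cm l -> Im l <> 0) by (unfold Cm; intros; lra).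
  assert (closed : i_ -> forall l, Im l <> 0 -> closable (gam l))
    by (intros Hi l Hl; eapply ess_selfadjoint_gamma_closable; eassumption).
  assert (forms : forall l, Im l <> 0 -> form_closable (M l) l <-> closable (gam l))
    by (intros l Hl; eapply form_closable_gamma; eassumption).
  (* The range of the closure of Gamma_0 does not involve l, so it serves as the common domain in
     (iii), (v) and (vi). *)
  assert (dom_gam : i_ -> forall l, Im l <> 0 -> forall h,
      rdom (rclosure (gam l)) h <-> ran_closure_G0 Astar G0 h).
  { intros Hi l Hl h. split;
      [apply dom_gamma_closure_sub | eapply ran_closure_G0_sub; eassumption]. }
  assert (dom_form : i_ -> forall l, Im l <> 0 -> forall h,
      dom_form_closure (M l) l h <-> ran_closure_G0 Astar G0 h).
  { intros Hi l Hl h. rewrite <- (dom_gam Hi l Hl h).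
    eapply dom_form_closure_gamma; [exact HU | exact Hl | apply closed; assumption]. }
  assert (from_ii : ii_ -> i_) by (intros [H1 H2]; eapply gamma_closable_ess_selfadjoint; eassumption).
  assert (from_iv : iv_ -> i_).
  { intros [H1 H2]. apply from_ii. split; apply forms; assumption. }
  split; [|split; [|split; [|split; [|split]]]].
  - split; [intro Hi; split; apply closed; assumption | exact from_ii].
  - split; [|intros [Hc _]; apply from_ii; split; apply Hc; assumption].
    intro Hi. split; [apply closed, Hi|].
    split; intros l Hl h; rewrite !dom_gam; auto; reflexivity.
  - split; [intro Hi; split; apply forms; auto | exact from_iv].
  - split; [|intros [Hc _]; apply from_iv; split; apply Hc; assumption].
    intro Hi. split; [intros l Hl; apply forms; auto|].
    split; intros l Hl h; rewrite !dom_form; auto; reflexivity.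
  - split.
    + intro Hi. split; [apply weyl_nevanlinna, HU|].
      split; (split; [intros l Hl; apply forms; auto |
        exists (ran_closure_G0 Astar G0); intros l Hl h; apply dom_form; auto]).
    + intros (_ & [Hp _] & [Hm _]). apply from_iv.
      split; [apply Hp; unfold Cp | apply Hm; unfold Cm]; simpl; lra.
  - intros Hi l Hl h. split; [|apply dom_gam; assumption].
    rewrite dom_form, dom_gam by assumption. reflexivity.
Qed.
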